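(* Let $\{\lambda_n\}_{n=0}^\infty$ be a non-trivial sequence of non-negative real numbers. Then $\{\lambda_n\}$ is a Hermite multiplier sequence if and only if it is a (classical) multiplier sequence and $\lambda_n\le\lambda_{n+1}$ for all $n\ge0$.
   Context: The Hermite polynomials $H_n(x)$ are defined by $\exp(2xt-t^2)=\sum_{n\ge0}\frac{H_n(x)}{n!}t^n$. A real sequence $\{\lambda_n\}$ is a Hermite multiplier sequence if the linear operator $T$ on $\mathbb{R}[x]$ with $T(H_n)=\lambda_nH_n$ for all $n$ maps real-rooted polynomials to real-rooted polynomials (constants count as real-rooted); it is a (classical) multiplier sequence if $x^n\mapsto\lambda_nx^n$ has this property. A sequence is trivial if there is $k\in\mathbb{N}$ with $\lambda_n=0$ for all $n\notin\{k,k+1\}$, non-trivial otherwise. *)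

(* Defs.v *)
From Stdlib Require Import Reals Lra Lia List Factorial.
Open Scope R_scope.

Definition lincomb (b : nat -> R -> R) (c : nat -> R) (n : nat) (x : R) : R :=
  sum_f_R0 (fun i => c i * b i x) n.

Definition monomial (k : nat) (x : R) : R := x ^ k.

(* Hermite polynomials: H_n(x) = n! * coefficient of t^n in
   exp(2xt) * exp(-t^2) = sum_{k <= n/2} (-1)^k n! / (k! (n-2k)!) (2x)^(n-2k). *)
Definition hermite (n : nat) (x : R) : R :=
  sum_f_R0 (fun k => (-1) ^ k * INR (fact n) / (INR (fact k) * INR (fact (n - 2 * k)))
                      * (2 * x) ^ (n - 2 * k)) (Nat.div2 n).

(* A polynomial function is real-rooted if it factors as c * prod (x - r_i)
   with all r_i real (constants, including 0, are real-rooted). *)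
Definition real_rooted (f : R -> R) : Prop :=
  exists (c : R) (rs : list R),
    forall x, f x = c * fold_right (fun r acc => (x - r) * acc) 1 rs.

Definition multiplier_seq_for (b : nat -> R -> R) (lam : nat -> R) : Prop :=
  forall (c : nat -> R) (n : nat),
    real_rooted (lincomb b c n) ->
    real_rooted (lincomb b (fun i => lam i * c i) n).

Definition hermite_multiplier_sequence (lam : nat -> R) : Prop :=
  multiplier_seq_for hermite lam.

Definition classical_multiplier_sequence (lam : nat -> R) : Prop :=
  multiplier_seq_for monomial lam.

Definition trivial_sequence (lam : nat -> R) : Prop :=
  exists k : nat, forall n : nat, n <> k -> n <> S k -> lam n = 0.

(* Main.v *)
Require Import Defs.
From Stdlib Require Import Reals Classical.
From mathcomp Require Import all_boot all_order all_algebra.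
From mathcomp Require Import complex Rstruct ring lra zify.
Set Implicit Arguments.
Unset Strict Implicit.
Unset Printing Implicit Defensive.
Import Order.TTheory GRing.Theory Num.Theory.

(* Write [E = exp(-D^2)]: in the variable [2x], [H_n] is [E x^n], so a Hermite
   multiplier sequence is one for which [E Lam E^-1] preserves real-rootedness,
   where [Lam x^n = lam_n x^n]; [E] itself preserves it, being the limit of
   [(1 - D^2/N)^N].
   Necessity: dilations turn [E] into [exp(-s^2 D^2)], and [s -> 0] gives the
   classical property. The image of [x^(n+2)] gives [lam_n <= lam_(n+2)] whenever
   [lam_(n+2) > 0], the image of [x^(n+4) - s x^(n+2)] excludes that the sequence
   stops, and log-concavity turns this into monotonicity.
   Sufficiency: with [mu_k] the k-th forward difference of [lam] at 0, [Lam] is the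
   sum of [mu_k/k! x^k D^k], and [E Lam E^-1] is the sum of [mu_k/k! (x - 2D)^k D^k].
   A nondecreasing multiplier sequence has [mu_k >= 0], and the polynomials
   [sum_k C(N,k) mu_k u^k] are real-rooted, hence have only nonpositive zeros. For
   [Im x > 0 > Im w] the number [w (x - 2w)] is never a nonpositive real, which makes
   the corresponding finite-order operators preserve zero-freeness of the upper
   half-plane; then [N -> oo]. *)

(** * Constant-coefficient differential operators and stability *)

Section ConstantCoefficientOperators.
Local Open Scope ring_scope.
Variable F : fieldType.
Implicit Types (e : nat -> F) (f g : {poly F}).

(** The formal power series [sum_k e k D^k] applied to [f], with [D] the derivative. A coefficient
    sequence rather than a polynomial is taken so that [exp(-D^2)] is covered. *)
Definition act e f : {poly F} := \sum_(k < size f) e k *: f^`(k).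

Lemma derivn_eq0 f k : (size f <= k)%N -> f^`(k) = 0.
Proof.
move=> h; apply/polyP => i; rewrite coef_derivn coef0 nth_default ?mul0rn //.
by apply: leq_trans h (leq_addr _ _).
Qed.

Lemma act_bound e f n : (size f <= n)%N -> act e f = \sum_(k < n) e k *: f^`(k).
Proof.
move=> h; rewrite /act -!(big_mkord xpredT (fun k => e k *: f^`(k))).
rewrite (big_cat_nat (leq0n _) h) /= -[LHS]addr0; congr (_ + _).
rewrite big_nat_cond big1 // => i.
by rewrite andbT => /andP[hi _]; rewrite derivn_eq0 // scaler0.
Qed.

Lemma eq_act e e' f : (forall k, (k < size f)%N -> e k = e' k) -> act e f = act e' f.
Proof. by move=> h; apply: eq_bigr => i _; rewrite h. Qed.

Lemma actD e f g : act e (f + g) = act e f + act e g.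
Proof.
set n := maxn (size f) (size g).
rewrite !(@act_bound e _ n) ?leq_maxl ?leq_maxr ?size_polyD //.
by rewrite -big_split; apply: eq_bigr => i _; rewrite derivnD scalerDr.
Qed.

Lemma act0 e : act e 0 = 0.
Proof. by rewrite /act size_poly0 big_ord0. Qed.

Lemma actZ e c f : act e (c *: f) = c *: act e f.
Proof.
rewrite (@act_bound e _ (size f)) ?size_scale_leq // /act scaler_sumr.
by apply: eq_bigr => i _; rewrite derivnZ !scalerA mulrC.
Qed.

Lemma act_sum e (I : Type) (r : seq I) (P : pred I) (G : I -> {poly F}) :
  act e (\sum_(i <- r | P i) G i) = \sum_(i <- r | P i) act e (G i).
Proof. by apply: (big_morph _ (@actD e) (act0 e)). Qed.

Lemma size_deriv_leq f : (size f^`() <= size f)%N.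
Proof.
by apply/leq_sizeP => j hj; rewrite coef_deriv nth_default ?mul0rn // ltnW.
Qed.

Lemma act_deriv e f : act e f^`() = (act e f)^`().
Proof.
rewrite (@act_bound e _ (size f)); last exact: size_deriv_leq.
rewrite /act raddf_sum /=; apply: eq_bigr => i _.
by rewrite derivZ -derivnS derivSn.
Qed.

Lemma coef_act e f n i : (size f <= n)%N ->
  (act e f)`_i = \sum_(k < n) e k * (f`_(k + i) *+ (k + i) ^_ k).
Proof.
move=> h; rewrite (act_bound e h) coef_sum; apply: eq_bigr => k _.
by rewrite coefZ coef_derivn.
Qed.

Lemma size_act e f : (size (act e f) <= size f)%N.
Proof.
apply/leq_sizeP => j hj; rewrite (coef_act e j (leqnn _)) big1 // => k _.
by rewrite nth_default ?mul0rn ?mulr0 // (leq_trans hj) // leq_addl.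
Qed.

Lemma actDl e e' f : act (fun k => e k + e' k) f = act e f + act e' f.
Proof. by rewrite -big_split; apply: eq_bigr => i _; rewrite scalerDl. Qed.

Lemma actZl c e f : act (fun k => c * e k) f = c *: act e f.
Proof. by rewrite /act scaler_sumr; apply: eq_bigr => i _; rewrite scalerA. Qed.

Lemma actMX (s f : {poly F}) : act (fun k => (s * 'X)`_k) f = act (fun k => s`_k) f^`().
Proof.
rewrite (@act_bound _ f (size f).+1) // big_ord_recl coefMX eqxx scale0r add0r.
rewrite (@act_bound _ f^`() (size f)); last exact: size_deriv_leq.
by apply: eq_bigr => i _; rewrite lift0 coefMX derivSn.
Qed.

Lemma act_id f : act (fun k => (k == 0%N)%:R) f = f.
Proof.
rewrite (@act_bound _ f (size f).+1) // big_ord_recl scale1r derivn0.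
by rewrite big1 ?addr0 // => i _; rewrite lift0 scale0r.
Qed.

(** Multiplying symbols composes operators, so a factorization of a symbol can be applied one linear
    factor at a time. *)
Lemma actM (s t f : {poly F}) :
  act (fun k => (s * t)`_k) f = act (fun k => s`_k) (act (fun k => t`_k) f).
Proof.
elim/poly_ind: s f => [|s c IH] f.
  have a0 g : act (fun k => (0 : {poly F})`_k) g = 0.
    by rewrite /act big1 // => i _; rewrite polyseq0 nth_nil scale0r.
  by rewrite mul0r !a0.
transitivity (act (fun k => (s * t * 'X)`_k + c * t`_k) f).
  apply: eq_act => k _; rewrite mulrDl coefD mulrAC mul_polyC coefZ //.
rewrite actDl actMX IH act_deriv -actMX actZl.
set g := act _ f.
transitivity (act (fun k => (s * 'X)`_k + c * (k == 0%N)%:R) g).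
  by rewrite actDl actZl act_id.
apply: eq_act.
move=> k _; rewrite coefD coefC; congr (_ + _).
by case: k => [|k]; rewrite ?mulr1 ?mulr0.
Qed.

End ConstantCoefficientOperators.

Section MapAct.
Local Open Scope ring_scope.

Lemma map_act (F G : fieldType) (phi : {rmorphism F -> G}) e (f : {poly F}) :
  map_poly phi (act e f) = act (fun k => phi (e k)) (map_poly phi f).
Proof.
rewrite /act size_map_poly rmorph_sum; apply: eq_bigr => i _ /=.
by rewrite map_polyZ derivn_map.
Qed.

End MapAct.

(** * Polynomials without zeros in the open upper half-plane *)

Section Stability.
Local Open Scope ring_scope.
Variable R : rcfType.
Local Notation C := R[i].
Local Notation Re := (@complex.Re R).
Local Notation Im := (@complex.Im R).
Implicit Types (z w : C) (f s : {poly C}).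

Lemma Im_add z w : Im (z + w) = Im z + Im w.
Proof. by case: z w => [a b] [c d]. Qed.

Lemma Re_add z w : Re (z + w) = Re z + Re w.
Proof. by case: z w => [a b] [c d]. Qed.

Lemma Im_opp z : Im (- z) = - Im z.
Proof. by case: z. Qed.

Lemma Im_mul z w : Im (z * w) = Re z * Im w + Im z * Re w.
Proof. by case: z w => [a b] [c d]. Qed.

Lemma Re_mul z w : Re (z * w) = Re z * Re w - Im z * Im w.
Proof. by case: z w => [a b] [c d]. Qed.

Definition sqnorm z := Re z ^+ 2 + Im z ^+ 2.

Lemma sqnorm_ge0 z : 0 <= sqnorm z.
Proof. by rewrite addr_ge0 ?sqr_ge0. Qed.

Lemma sqnorm_eq0 z : (sqnorm z == 0) = (z == 0).
Proof. by case: z => a b; rewrite eq_complex /= paddr_eq0 ?sqr_ge0 ?sqrf_eq0. Qed.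

Lemma sqnorm_gt0 z : (0 < sqnorm z) = (z != 0).
Proof. by rewrite lt_def sqnorm_eq0 sqnorm_ge0 andbT. Qed.

Lemma sqnormM z w : sqnorm (z * w) = sqnorm z * sqnorm w.
Proof. rewrite /sqnorm Re_mul Im_mul; ring. Qed.

Lemma Im_inv z : Im z^-1 = - (Im z / sqnorm z).
Proof. by case: z. Qed.

Definition stable f := forall z, 0 < Im z -> f.[z] != 0.

Lemma horner_prod_XsubC (K : fieldType) (rs : seq K) (z : K) :
  (\prod_(r <- rs) ('X - r%:P)).[z] = \prod_(r <- rs) (z - r).
Proof. by rewrite horner_prod; apply: eq_bigr => r _; rewrite hornerXsubC. Qed.

Lemma logderiv_prod (K : fieldType) (rs : seq K) (z : K) :
  (forall r, r \in rs -> z - r != 0) ->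
  (\prod_(r <- rs) ('X - r%:P))^`().[z]
  = (\prod_(r <- rs) ('X - r%:P)).[z] * \sum_(r <- rs) (z - r)^-1.
Proof.
elim: rs => [|r rs IH] h; first by rewrite !big_nil derivC horner0 mulr0.
rewrite !big_cons derivM derivXsubC mul1r hornerD !hornerM hornerXsubC IH.
  have h0 := h r (mem_head _ _); field; exact: h0.
by move=> r' hr; apply: h; rewrite inE hr orbT.
Qed.

Lemma stable_neq0 f : stable f -> f != 0.
Proof.
move=> h; apply/eqP => f0; have /h : 0 < Im 'i%C by rewrite /= ltr01.
by rewrite f0 horner0 eqxx.
Qed.

(** The logarithmic derivative is the sum of [1/(z - r)] over the roots. Each [z - r] lies in the
    upper half-plane, so its inverse lies in the lower one; the size bound makes the sum nonempty
    and the inequality strict. *)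
Lemma stable_logderiv f z : stable f -> (1 < size f)%N -> 0 < Im z ->
  Im (f^`().[z] / f.[z]) < 0.
Proof.
move=> hf sf hz; have [rs fE] := closed_field_poly_normal f.
have f0 := stable_neq0 hf.
have lc0 : lead_coef f != 0 by rewrite lead_coef_eq0.
have rsIm r : r \in rs -> Im r <= 0.
  move=> hr; rewrite leNgt; apply/negP => /hf /negP; apply.
  rewrite fE hornerZ mulf_eq0 horner_prod_XsubC prodf_seq_eq0.
  by apply/orP; right; apply/hasP; exists r; rewrite ?subrr /=.
have zr r : r \in rs -> 0 < Im (z - r).
  by move=> /rsIm hr; rewrite Im_add Im_opp; lra.
have zr0 r : r \in rs -> z - r != 0.
  by move=> /zr; apply: contraTneq => ->; rewrite /= ltxx.
have fz := hf z hz.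
have -> : f^`().[z] / f.[z] = \sum_(r <- rs) (z - r)^-1.
  rewrite [in f^`()]fE derivZ hornerZ logderiv_prod // mulrA -hornerZ -fE.
  by rewrite mulrC mulKf.
have : (0 < size rs)%N.
  by move: sf; rewrite fE size_scale // size_prod_XsubC.
clear - zr zr0; elim: rs zr zr0 => // r rs IH zr zr0 _.
have hr : Im (z - r)^-1 < 0.
  rewrite Im_inv oppr_lt0 divr_gt0 ?sqnorm_gt0 ?zr0 ?zr ?mem_head //.
rewrite big_cons Im_add; case: rs IH zr zr0 => [|r' rs] IH zr zr0.
  by rewrite big_nil addr0.
rewrite -[X in _ < X]addr0 ltrD // IH // => x hx.
  by rewrite zr // inE hx orbT.
by rewrite zr0 // inE hx orbT.
Qed.

(** Hermite-Poulain argument: each factor [D - r] of the symbol has [Im r >= 0], and a zero of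
    [g' - r g] would give [g'/g = r], against [stable_logderiv]. The last hypothesis only serves to
    keep the image nonzero. *)
Lemma act_stable s f : (forall w, Im w < 0 -> s.[w] != 0) -> stable f ->
  (exists2 m, (m < size f)%N & s`_m != 0) -> stable (act (fun k => s`_k) f).
Proof.
move=> hs hf hm.
suff: act (fun k => s`_k) f = 0 \/ stable (act (fun k => s`_k) f).
  case=> // s0; exfalso.
  have [m /andP[hm1 hm2] mmin] :
     {m | (m < size f)%N && (s`_m != 0) & forall k, (k < size f)%N && (s`_k != 0) -> (m <= k)%N}.
    have ex : exists m, (m < size f)%N && (s`_m != 0).
      by case: hm => m a b; exists m; rewrite a b.
    by exists (ex_minn ex); case: ex_minnP.
  (* With [m] the order of vanishing of [s] at 0, this is the top coefficient of the image: only
     [s_m] times the leading coefficient of [f] and a positive integer contributes. *)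
  have := congr1 (fun p : {poly C} => p`_((size f).-1 - m)) s0.
  rewrite (coef_act _ _ (leqnn _)) coef0 (bigD1 (Ordinal hm1)) //=.
  have -> : (m + ((size f).-1 - m) = (size f).-1)%N by lia.
  rewrite big1 ?addr0.
    move/eqP; rewrite mulf_eq0 (negPf hm2) /= mulrn_eq0 -lead_coefE.
    rewrite lead_coef_eq0 (negPf (stable_neq0 hf)) orbF => /eqP.
    move=> e0; have := ffact_gt0 (size f).-1 m; rewrite e0; lia.
  move=> k hk; have [lt|ge] := ltnP k m.
    have [->|h] := eqVneq s`_k 0; first by rewrite mul0r.
    by have := mmin k; rewrite ltn_ord h => /(_ isT); rewrite leqNgt lt.
  have : m != k by apply: contra hk => /eqP h; apply/eqP/val_inj.
  move=> ne; have {}ne : (m < nat_of_ord k)%N by rewrite ltn_neqAle ne.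
  have le : (size f <= k + ((size f).-1 - m))%N.
    by move: (nat_of_ord k) ne {ge hk} => j ne; clear -ne hm1; lia.
  by rewrite [f`__]nth_default ?mul0rn ?mulr0.
have [rs sE] := closed_field_poly_normal s.
have s0 : s != 0.
  by apply/eqP => s0; case: hm => m _; rewrite s0 coef0 eqxx.
have rsIm r : r \in rs -> 0 <= Im r.
  move=> hr; rewrite leNgt; apply/negP => /hs /negP; apply.
  rewrite sE hornerZ mulf_eq0 horner_prod_XsubC prodf_seq_eq0.
  by apply/orP; right; apply/hasP; exists r; rewrite ?subrr /=.
have -> : act (fun k => s`_k) f
  = lead_coef s *: act (fun k => (\prod_(z <- rs) ('X - z%:P))`_k) f.
  by rewrite -actZl; apply: eq_act => k _; rewrite [in LHS]sE coefZ.
(* The alternative [= 0] is carried through the induction because a factor with [r = 0] kills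
   constants. *)
suff: act (fun k => (\prod_(z <- rs) ('X - z%:P))`_k) f = 0 \/
   stable (act (fun k => (\prod_(z <- rs) ('X - z%:P))`_k) f).
  case=> [->|h]; [by left; rewrite scaler0|right => z hz].
  by rewrite hornerZ mulf_neq0 ?lead_coef_eq0 ?h.
elim: rs rsIm {sE} => [|r rs IH] rsIm.
  right; rewrite big_nil -[X in stable X](_ : f = _) //.
  by rewrite -[LHS]act_id; apply: eq_act => k _; rewrite coef1.
rewrite big_cons actM; set g := act _ f in IH *.
have -> : act (fun k => ('X - r%:P)`_k) g = g^`() - r *: g.
  rewrite (@eq_act _ _ (fun k => (1 * 'X)`_k + (- r) * (k == 0%N)%:R)).
    rewrite actDl actMX actZl act_id scaleNr; congr (_ - _).
    by rewrite -[RHS]act_id; apply: eq_act => k _; rewrite coef1.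
  move=> k _; rewrite mul1r coefB coefC; case: (k == 0%N) => //=.
    by rewrite mulr1.
  by rewrite mulr0 subr0 addr0.
have hr : 0 <= Im r by rewrite rsIm ?mem_head.
have [|g0|hg] := IH.
- by move=> x hx; rewrite rsIm // inE hx orbT.
- by left; rewrite g0 deriv0 scaler0 subr0.
have [sg|sg] := leqP (size g) 1.
  rewrite (size1_polyC sg) derivC sub0r.
  have [->|r0] := eqVneq r 0; first by left; rewrite scale0r oppr0.
  right=> z hz; rewrite hornerN oppr_eq0 hornerZ mulf_neq0 //.
  by rewrite -size1_polyC // hg.
right=> z hz; have gz := hg z hz.
rewrite hornerD hornerN hornerZ; apply/eqP => e0.
have := stable_logderiv hg sg hz.
have -> : g^`().[z] / g.[z] = r by rewrite (subr0_eq e0) mulfK.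
by rewrite ltNge hr.
Qed.

End Stability.

(** * Real-rooted polynomials *)

Section RealRootedPolynomials.
Local Open Scope ring_scope.
Variable R : rcfType.
Local Notation C := R[i].
Local Notation Re := (@complex.Re R).
Local Notation Im := (@complex.Im R).
Implicit Types (z w : C) (P Q : {poly R}).

Local Notation cpoly := (map_poly (real_complex R)).

Definition rr P := exists (c : R) (rs : seq R), P = c *: \prod_(r <- rs) ('X - r%:P).

Lemma cpolyXsubC (r : R) : cpoly ('X - r%:P) = 'X - (r%:C%C)%:P.
Proof. by rewrite rmorphB /= map_polyX map_polyC. Qed.

Lemma cpoly_prod (rs : seq R) :
  cpoly (\prod_(r <- rs) ('X - r%:P)) = \prod_(r <- [seq r%:C%C | r <- rs]) ('X - r%:P).
Proof. by rewrite rmorph_prod big_map; apply: eq_bigr => r _; rewrite /= cpolyXsubC. Qed.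

Lemma rr_stable P : rr P -> P = 0 \/ stable (cpoly P).
Proof.
move=> [c [rs ->]]; have [->|c0] := eqVneq c 0; first by left; rewrite scale0r.
right=> z hz; rewrite map_polyZ hornerZ mulf_neq0 ?fmorph_eq0 //.
rewrite cpoly_prod horner_prod_XsubC prodf_seq_neq0; apply/allP => r /mapP[x _ ->].
by apply: contraTneq hz => h; rewrite (subr0_eq h) /= ltxx.
Qed.

Lemma cpoly_conj P z : (cpoly P).[z^*%C] = ((cpoly P).[z])^*%C.
Proof.
elim/poly_ind: P => [|P c IH]; first by rewrite rmorph0 !horner0 /= oppr0.
rewrite rmorphD rmorphM /= map_polyX map_polyC !hornerE IH.
by case: (cpoly P).[z] => a b; case: z {IH} => x y /=; simpc; congr Complex; ring.
Qed.

(** Non-real zeros of a real polynomial come in conjugate pairs, one of each pair being in the upper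
    half-plane. *)
Lemma stable_rr P : stable (cpoly P) -> rr P.
Proof.
move=> hP; have [zs E] := closed_field_poly_normal (cpoly P).
have lc0 : lead_coef (cpoly P) != 0 by rewrite lead_coef_eq0 stable_neq0.
have zroot z : z \in zs -> (cpoly P).[z] = 0.
  move=> hz; apply/eqP; rewrite E hornerZ mulf_eq0 horner_prod_XsubC prodf_seq_eq0.
  by apply/orP; right; apply/hasP; exists z; rewrite ?subrr /=.
have zreal z : z \in zs -> z = (Re z)%:C%C.
  move=> /zroot hz; have h1 : Im z <= 0.
    by rewrite leNgt; apply/negP => /hP; rewrite hz eqxx.
  have h2 : Im (z^*%C) <= 0.
    by rewrite leNgt; apply/negP => /hP; rewrite cpoly_conj hz /= oppr0 eqxx.
  case: z h1 h2 {hz} => a b /= h1 h2; congr Complex; lra.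
exists (lead_coef P), (map Re zs).
apply: (@map_poly_inj _ _ (real_complex R)).
rewrite E map_polyZ lead_coef_map cpoly_prod; congr (_ *: _).
by rewrite -map_comp big_map; apply: eq_big_seq => z /zreal {1}->.
Qed.

Lemma rrP P : rr P <-> P = 0 \/ stable (cpoly P).
Proof.
split=> [|[->|]]; [exact: rr_stable| |exact: stable_rr].
by exists 0, [::]; rewrite scale0r.
Qed.

Lemma rr0 : rr 0.
Proof. by apply/rrP; left. Qed.

Lemma rrZ c P : rr P -> rr (c *: P).
Proof. by move=> [d [rs ->]]; exists (c * d), rs; rewrite scalerA. Qed.

Lemma rrM P Q : rr P -> rr Q -> rr (P * Q).
Proof.
move=> [c [rs ->]] [d [ss ->]]; exists (c * d), (rs ++ ss).
by rewrite big_cat /= -scalerAl -scalerAr scalerA.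
Qed.

Lemma rr_XsubC (r : R) : rr ('X - r%:P).
Proof. by exists 1, [:: r]; rewrite big_seq1 scale1r. Qed.

Lemma rr1 : rr 1.
Proof. by exists 1, [::]; rewrite big_nil scale1r. Qed.

Lemma rrX P n : rr P -> rr (P ^+ n).
Proof.
by move=> h; elim: n => [|n IH]; rewrite ?expr0 ?exprS; [exact: rr1|exact: rrM].
Qed.

Lemma rr_deriv P : rr P -> rr P^`().
Proof.
move=> /rr_stable[->|hP]; first by rewrite deriv0; exact: rr0.
have [s1|s1] := leqP (size P) 1.
  by rewrite (size1_polyC s1) derivC; exact: rr0.
apply: stable_rr => z hz; rewrite -deriv_map; apply/eqP => h0.
have s2 : (1 < size (cpoly P))%N by rewrite size_map_poly.
by have := stable_logderiv hP s2 hz; rewrite h0 mul0r /= ltxx.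
Qed.

Lemma rr_derivn P n : rr P -> rr P^`(n).
Proof. by move=> h; elim: n => [|n IH]; rewrite ?derivn0 ?derivnS //; exact: rr_deriv. Qed.

Lemma rr_comp_scale P (a : R) : 0 < a -> rr P -> rr (P \Po (a *: 'X)).
Proof.
move=> a0 /rr_stable[->|hP]; first by rewrite comp_poly0; exact: rr0.
apply: stable_rr => z hz; rewrite map_comp_poly horner_comp map_polyZ map_polyX.
rewrite hornerZ hornerX; apply: hP.
by case: z hz => x y /= hy; rewrite mul0r addr0 mulr_gt0.
Qed.

(** Each linear factor contributes [(x - r)^2 + y^2]. This takes the place of Hurwitz's theorem in
    [rr_closed]. *)
Lemma rr_sqnorm_homo P (x y y' : R) : rr P -> 0 <= y <= y' ->
  sqnorm (cpoly P).[Complex x y] <= sqnorm (cpoly P).[Complex x y'].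
Proof.
move=> [c [rs ->]] hy; rewrite map_polyZ !hornerZ !sqnormM ler_wpM2l ?sqnorm_ge0 //.
rewrite cpoly_prod !horner_prod_XsubC !big_map.
elim: rs => [|r rs IH]; first by rewrite !big_nil.
rewrite !big_cons !sqnormM ler_pM ?sqnorm_ge0 // /sqnorm /= subr0 lerD2l.
by rewrite subr0 ler_sqr ?nnegrE; lra.
Qed.

Lemma coef_XsubCM (r : R) Q i :
  (('X - r%:P) * Q)`_i = (if i is j.+1 then Q`_j else 0) - r * Q`_i.
Proof. by rewrite mulrBl coefB mul_polyC coefZ coefXM; case: i. Qed.

Lemma size_prod_le (c : R) rs n : c != 0 ->
  (size (c *: \prod_(r <- rs) ('X - r%:P)) <= n.+1)%N -> (size rs <= n)%N.
Proof. by move=> c0; rewrite size_scale // size_prod_XsubC. Qed.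

Lemma rr_quadratic P : rr P -> (size P <= 3)%N -> 4 * P`_0 * P`_2 <= P`_1 ^+ 2.
Proof.
move=> [c [rs ->]]; have [->|c0] := eqVneq c 0.
  by rewrite scale0r !coef0 => _; rewrite mulr0 expr0n.
move=> /(size_prod_le c0); rewrite !coefZ.
case: rs => [|r [|s [|//]]] _; rewrite ?big_cons ?big_nil ?mulr1.
- by rewrite !coef1 /=; lra.
- rewrite !coefB !coefX !coefC /=; have := sqr_ge0 c; nra.
rewrite !coef_XsubCM !coefB !coefX !coefC /=.
have := sqr_ge0 (c * (r - s)); lra.
Qed.

(** The right side minus the left is the discriminant divided by 27, for a cubic written with
    binomial weights 1, 3, 3, 1; lower degrees are included. *)
Lemma rr_cubic P (b0 b1 b2 b3 : R) : rr P -> (size P <= 4)%N ->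
  P`_0 = b0 -> P`_1 = 3 * b1 -> P`_2 = 3 * b2 -> P`_3 = b3 ->
  (b1 * b2 - b0 * b3) ^+ 2 <= 4 * (b1 ^+ 2 - b0 * b2) * (b2 ^+ 2 - b1 * b3).
Proof.
move=> [c [rs ->]]; have [->|c0] := eqVneq c 0.
  rewrite scale0r !coef0 => _ <- h1 h2 <-.
  have -> : b1 = 0 by lra.
  have -> : b2 = 0 by lra.
  lra.
move=> /(size_prod_le c0); rewrite !coefZ.
case: rs => [|r [|s [|t [|//]]]] _; rewrite ?big_cons ?big_nil ?mulr1.
- rewrite !coef1 /= => <- h1 h2 <-.
  have -> : b1 = 0 by lra.
  have -> : b2 = 0 by lra.
  lra.
- rewrite !coefB !coefX !coefC /= => <- h1 h2 <-.
  have -> : b1 = c / 3 by lra.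
  have -> : b2 = 0 by lra.
  rewrite !(mulr0, mul0r, subr0, oppr0) expr0n /= mulr0; lra.
- rewrite !coef_XsubCM !coefB !coefX !coefC /= => <- h1 h2 <-.
  have -> : b1 = - c * (r + s) / 3 by lra.
  have -> : b2 = c / 3 by lra.
  have := sqr_ge0 (c ^+ 2 * (r - s)); lra.
rewrite !coef_XsubCM !coefB !coefX !coefC /= => <- h1 h2 <-.
have -> : b1 = c * (r * s + s * t + t * r) / 3 by lra.
have -> : b2 = - c * (r + s + t) / 3 by lra.
have := sqr_ge0 (c ^+ 2 * (r - s) * (s - t) * (t - r)); lra.
Qed.

(** A nonzero polynomial with nonnegative coefficients is positive at every positive real. *)
Lemma rr_nonneg_root P z : rr P -> P != 0 -> (forall i, 0 <= P`_i) ->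
  (cpoly P).[z] = 0 -> Im z = 0 /\ Re z <= 0.
Proof.
move=> /rr_stable[->|hP]; first by rewrite eqxx.
move=> P0 Pge hz.
have i0 : Im z = 0.
  apply: le_anti; apply/andP; split; rewrite leNgt; apply/negP.
    by move=> /hP; rewrite hz eqxx.
  move=> h; have /hP : 0 < Im (z^*%C) by case: (z) h => a b /=; rewrite oppr_gt0.
  by rewrite cpoly_conj hz /= oppr0 eqxx.
split=> //; rewrite leNgt; apply/negP => h.
have zE : z = (Re z)%:C%C by case: (z) i0 => a b /= ->.
move: hz; rewrite zE horner_map => /eqP; rewrite fmorph_eq0 => /eqP h0.
have : 0 < P.[Re z].
  rewrite horner_coef (polySpred P0) big_ord_recr /=.
  rewrite ltr_wpDl ?sumr_ge0 // => [i _|]; first by rewrite mulr_ge0 // exprn_ge0 // ltW.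
  by rewrite mulr_gt0 ?exprn_gt0 // lt_def Pge -lead_coefE lead_coef_eq0 P0.
by rewrite h0 ltxx.
Qed.

(** The constant term excludes the root 0, so all roots are negative and every coefficient up to the
    degree is positive. *)
Lemma rr_no_gap P i j : rr P -> (forall k, 0 <= P`_k) -> 0 < P`_0 -> 0 < P`_j ->
  (i <= j)%N -> 0 < P`_i.
Proof.
move=> hP Pge P0 Pj ij; have Pn0 : P != 0.
  by apply: contraTneq P0 => ->; rewrite coef0 ltxx.
have [c [rs E]] := hP.
have c0 : c != 0 by apply: contraNneq Pn0 => c0; rewrite E c0 scale0r.
have cp : 0 < c.
  rewrite lt_def c0 /=; have := Pge (size rs).
  have <- : lead_coef P = c.
    by rewrite E lead_coefZ (monicP (monic_prod_XsubC _ _ _)) mulr1.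
  by rewrite lead_coefE E size_scale // size_prod_XsubC.
have rsn r : r \in rs -> r < 0.
  move=> hr; have Pr : P.[r] = 0.
    apply/eqP; rewrite E hornerZ mulf_eq0 horner_prod_XsubC prodf_seq_eq0.
    by apply/orP; right; apply/hasP; exists r; rewrite ?subrr /=.
  have [|_] := @rr_nonneg_root P (r%:C%C) hP Pn0 Pge.
    by rewrite horner_map /= Pr.
  rewrite /= le_eqVlt => /orP[/eqP r0|//].
  by move: Pr P0; rewrite r0 horner_coef0 => ->; rewrite ltxx.
have js : (j <= size rs)%N.
  rewrite leqNgt; apply/negP => h; move: Pj; rewrite E nth_default ?ltxx //.
  by rewrite size_scale // size_prod_XsubC.
have pos : forall k, (k <= size rs)%N -> 0 < (\prod_(r <- rs) ('X - r%:P))`_k.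
  clear - rsn; elim: rs rsn => [|r rs IH] rsn k hk.
    by rewrite big_nil coef1; case: k hk => //= _; exact: ltr01.
  have IH' k' := IH (fun x hx => rsn x (mem_behead (s := r :: rs) hx)) k'.
  have r0 := rsn r (mem_head _ _).
  rewrite big_cons coef_XsubCM; case: k hk => [_|k hk].
    by rewrite sub0r oppr_gt0 nmulr_rlt0 // IH'.
  have h1 := IH' _ hk; rewrite ltr_wpDr // oppr_ge0 nmulr_rle0 //.
  have [lt|ge] := leqP k.+1 (size rs); first exact/ltW/IH'.
  by rewrite nth_default // size_prod_XsubC.
by rewrite E coefZ mulr_gt0 // pos // (leq_trans ij).
Qed.

Lemma Im_sum (I : Type) (r : seq I) (F : I -> C) :
  Im (\sum_(i <- r) F i) = \sum_(i <- r) Im (F i).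
Proof. by apply: (big_morph Im (@Im_add R)). Qed.

(* With [t = -1/(1+z)] in the upper half-plane, [(1+z)(1+r)/(z-r) = 1/(t + 1/(1+r))]
   lies in the lower one, for every root [r <> -1]. *)
Lemma rr_polar P n : rr P -> (size P <= n.+1)%N ->
  rr ((1 + 'X) * P^`() - n%:R *: P).
Proof.
move=> [c [rs E]]; have [c0|c0] := eqVneq c 0.
  by rewrite E c0 scale0r deriv0 mulr0 scaler0 subr0 => _; exact: rr0.
move=> sP; have {sP} dn : (size rs <= n)%N by move: sP; rewrite E; exact: size_prod_le.
(* The exceptional case is [P = c (1 + X)^n], where the expression vanishes identically. *)
have [/andP[/all_pred1P rs1 /eqP sn]|nall] := boolP (all (pred1 (-1)) rs && (size rs == n)).
  have -> : P = c *: (1 + 'X) ^+ n.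
    rewrite E rs1 big_nseq -/(nseq _ _) sn iter_mulr_1; congr (_ *: _ ^+ _).
    by rewrite polyCN polyC1 opprK addrC.
  rewrite derivZ deriv_exp derivD derivX -polyC1 derivC add0r mul1r.
  case: n {dn sn} => [|n]; first by rewrite mulr0n scaler0 mulr0 scale0r subr0; exact: rr0.
  rewrite -scalerAr mulrnAr -exprS polyC1 -scaler_nat scalerA mulrC -scalerA subrr.
  exact: rr0.
apply: stable_rr => z hz.
have Pz : (cpoly P).[z] != 0.
  have [P0|] := rr_stable (ex_intro _ c (ex_intro _ rs E)); last exact.
  move: P0 => /eqP; rewrite E scaler_eq0 (negPf c0) /=.
  by rewrite (negPf (monic_neq0 (monic_prod_XsubC _ _ _))).
have zr0 r : z - r%:C%C != 0.
  by apply: contraTneq hz => h; rewrite (subr0_eq h) /= ltxx.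
have P'z : (cpoly P)^`().[z] = (cpoly P).[z] * \sum_(r <- rs) (z - r%:C%C)^-1.
  rewrite E map_polyZ derivZ !hornerZ cpoly_prod logderiv_prod ?big_map ?mulrA //.
  by move=> _ /mapP[r _ ->].
rewrite rmorphB rmorphM /= rmorphD rmorph1 /= map_polyX map_polyZ -deriv_map.
rewrite !hornerE P'z; apply/eqP; set S := \sum_(r <- rs) _ => h0.
have hS : (1 + z) * S = n%:R.
  apply: (mulfI Pz); apply/eqP; rewrite -subr_eq0 -[X in _ == X]h0 rmorph_nat.
  by apply/eqP; ring.
(* [G r] equals [(1 + z)(1 + r)/(z - r)], written so that its imaginary part is visibly [<= 0]. At a
   zero [z] these terms sum to [(1 + z)(n - size rs)], whose imaginary part is [>= 0]; hence all
   vanish, which is the exceptional case. *)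
pose G r := (1 + r%:C%C) * (1 + (1 + r%:C%C) / (z - r%:C%C)) : C.
have GE : \sum_(r <- rs) G r = (1 + z) * (n - size rs)%:R.
  transitivity (\sum_(r <- rs) ((1 + z) * ((1 + z) / (z - r%:C%C)) - (1 + z))).
    by apply: eq_bigr => r _; rewrite /G; field; exact: zr0.
  rewrite sumrB -mulr_sumr -mulr_sumr hS big_const_seq count_predT.
  by rewrite iter_addr_0 natrB // mulrBr mulr_natr [in RHS]mulr_natr.
have GIm r : Im (G r) = - ((1 + r) ^+ 2 * (Im z / sqnorm (z - r%:C%C))).
  rewrite /G Im_mul [in X in _ + X * _]Im_add /= addr0 mul0r addr0 Im_add /= add0r.
  rewrite Im_mul /= addr0 mul0r addr0 Im_inv Im_add Im_opp /= subr0; ring.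
have T0 r : 0 <= (1 + r) ^+ 2 * (Im z / sqnorm (z - r%:C%C)).
  by rewrite mulr_ge0 ?sqr_ge0 // divr_ge0 ?sqnorm_ge0 // ltW.
have := congr1 Im GE; rewrite Im_sum (eq_bigr _ (fun r _ => GIm r)) sumrN.
have -> : Im ((1 + z) * (n - size rs)%:R) = Im z * (n - size rs)%:R.
  rewrite -(rmorph_nat (real_complex R)) Im_mul /= mulr0 add0r; case: (z) => x y /=.
  by rewrite add0r.
move=> hE; have h1 : 0 <= Im z * (n - size rs)%:R by rewrite mulr_ge0 // ltW.
have h2 : 0 <= \sum_(r <- rs) (1 + r) ^+ 2 * (Im z / sqnorm (z - r%:C%C)) by exact: sumr_ge0.
have e1 : Im z * (n - size rs)%:R = 0 by lra.
have e2 : \sum_(r <- rs) (1 + r) ^+ 2 * (Im z / sqnorm (z - r%:C%C)) = 0 by lra.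
move/negP: nall; apply; apply/andP; split; last first.
  move: e1 => /eqP; rewrite mulf_eq0 (gt_eqF hz) /= pnatr_eq0; lia.
apply/allP => r hr /=; rewrite -subr_eq0 opprK.
move: e2 => /eqP; rewrite psumr_eq0 => [|i _]; last exact: T0.
move=> /allP /(_ r hr) /=; rewrite mulf_eq0 sqrf_eq0 mulf_eq0 invr_eq0 sqnorm_eq0.
by rewrite (negPf (zr0 r)) (gt_eqF hz) !orbF addrC.
Qed.

End RealRootedPolynomials.

(** * Binomial sums and forward differences *)

Section Pascal.
Local Open Scope ring_scope.

(** Pascal's rule on the pairs [(k, j)] with [k + j] fixed. Used both for scalars in [binsumS] and
    for polynomials in [act_eps_Xn_mul]. *)
Lemma sum_pascal (V : nmodType) n (F : nat -> nat -> V) :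
  \sum_(k < n.+2) F k (n.+1 - k)%N *+ 'C(n.+1, k) =
  \sum_(k < n.+1) F k (n - k).+1 *+ 'C(n, k) + \sum_(k < n.+1) F k.+1 (n - k)%N *+ 'C(n, k).
Proof.
rewrite big_ord_recl.
under eq_bigr => k _ do rewrite lift0 binS mulrnDr subSS.
rewrite big_split /= addrA; congr (_ + _).
rewrite [in LHS]big_ord_recr /= (@bin_small n n.+1) // mulr0n addr0 [in RHS]big_ord_recl.
congr (_ + _); first by rewrite !bin0 !subn0.
by apply: eq_bigr => k _; rewrite lift0 (subnSK (ltn_ord k)).
Qed.

End Pascal.

Section BinomialSums.
Local Open Scope ring_scope.
Variable K : comRingType.
Implicit Types (b : nat -> K) (x y : K).

Definition diff b k := b k.+1 - b k.

Definition diffs b k := iter k diff b 0%N.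

Lemma diffs_shift b k : diffs (fun i => b i.+1) k = diffs b k + diffs b k.+1.
Proof.
have h i : iter k diff (fun i => b i.+1) i = iter k diff b i.+1.
  by elim: k i => //= k IH i; rewrite /diff !IH.
by rewrite /diffs h /= /diff addrC subrK.
Qed.

(** Homogeneous form of the polynomial [jensen] below, convenient for Moebius changes of
    variable. *)
Definition binsum n b x y := \sum_(k < n.+1) (b k * x ^+ k * y ^+ (n - k)) *+ 'C(n, k).

Lemma eq_binsum n b b' x y : b =1 b' -> binsum n b x y = binsum n b' x y.
Proof. by move=> h; apply: eq_bigr => k _; rewrite h. Qed.

Lemma binsumD n b b' x y :
  binsum n (fun k => b k + b' k) x y = binsum n b x y + binsum n b' x y.
Proof. by rewrite -big_split; apply: eq_bigr => k _; rewrite /= !mulrDl mulrnDl. Qed.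

Lemma binsumS n b x y :
  binsum n.+1 b x y = y * binsum n b x y + x * binsum n (fun i => b i.+1) x y.
Proof.
rewrite /binsum (@sum_pascal _ _ (fun k j => b k * x ^+ k * y ^+ j)) !mulr_sumr.
congr (_ + _); apply: eq_bigr => k _; rewrite exprS mulrnAr; congr (_ *+ _); ring.
Qed.

(** Umbrally, [(1 + x Delta)^n = ((1 - x) + x E)^n], where [E = 1 + Delta] is the shift. *)
Lemma binsum_diffs n b x : binsum n (diffs b) x 1 = binsum n b x (1 - x).
Proof.
elim: n b => [|n IH] b.
  by rewrite /binsum !big_ord1 /= !expr0.
rewrite binsumS mul1r [RHS]binsumS -!IH.
rewrite (eq_binsum _ _ _ (diffs_shift b)) binsumD; ring.
Qed.

(** The case [x = 1] of [binsum_diffs], where the powers of [1 - x] kill every term but the last. *)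
Lemma newton_forward b n : b n = \sum_(k < n.+1) diffs b k *+ 'C(n, k).
Proof.
have := binsum_diffs n b 1; rewrite subrr {2}/binsum big_ord_recr /= big1 ?add0r => [|k _].
  rewrite subnn !expr1n expr0 !mulr1 binn mulr1n => <-.
  by apply: eq_bigr => k _; rewrite !expr1n !mulr1.
by rewrite expr0n subn_eq0 leqNgt ltn_ord mulr0 mul0rn.
Qed.

End BinomialSums.

(** * Jensen polynomials of a sequence and of its differences *)

Section JensenPolynomials.
Local Open Scope ring_scope.
Variable R : rcfType.
Local Notation C := R[i].
Local Notation cpoly := (map_poly (real_complex R)).
Implicit Types (b : nat -> R).

Definition jensen n b : {poly R} := \poly_(k < n.+1) (b k *+ 'C(n, k)).

Lemma coef_jensen n b k : (jensen n b)`_k = b k *+ 'C(n, k).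
Proof.
rewrite coef_poly ltnS; case: leqP => // h; by rewrite bin_small // mulr0n.
Qed.

Lemma size_jensen n b : (size (jensen n b) <= n.+1)%N.
Proof. exact: size_poly. Qed.

Lemma horner_jensen n b (z : C) :
  (cpoly (jensen n b)).[z] = binsum n (fun k => (b k)%:C%C) z 1.
Proof.
rewrite (@horner_coef_wide _ n.+1) ?size_map_poly ?size_jensen //.
apply: eq_bigr => k _; rewrite coef_map coef_jensen /= rmorphMn /= expr1n mulr1.
by rewrite mulrnAl.
Qed.

Definition jensen_rr b := forall n, rr (jensen n b).

Lemma jensen_rr_shift b : jensen_rr b -> jensen_rr (fun i => b i.+1).
Proof.
move=> h n; have -> : jensen n (fun i => b i.+1) = n.+1%:R^-1 *: (jensen n.+1 b)^`().
  apply/polyP => k; rewrite coefZ coef_deriv !coef_jensen -mulrnA mulnC -mul_bin_diag.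
  by rewrite mulnC mulrnA -[X in _ = _ * X]mulr_natl mulKf ?pnatr_eq0.
exact/rrZ/rr_deriv.
Qed.

(** Up to the factor [n + 1], the Jensen polynomial of [diff b] is the polynomial of [rr_polar]
    built from [jensen n.+1 b], a polar derivative at [-1]. *)
Lemma jensen_rr_diff b : jensen_rr b -> jensen_rr (diff b).
Proof.
move=> h n; have := rr_polar (h n.+1) (size_jensen _ _).
move=> /(rrZ n.+1%:R^-1); congr rr; apply/polyP => k.
rewrite coefZ mulrDl mul1r coefB coefD coefXM coefZ !coef_deriv !coef_jensen.
have e1 : b k.+1 *+ 'C(n.+1, k.+1) *+ k.+1 = n.+1%:R * (b k.+1 *+ 'C(n, k)).
  by rewrite -mulrnA mulnC -mul_bin_diag mulnC mulrnA mulr_natl.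
have e2 : (if k == 0%N then 0 else b k.-1.+1 *+ 'C(n.+1, k.-1.+1) *+ k.-1.+1)
          - n.+1%:R * (b k *+ 'C(n.+1, k)) = - (n.+1%:R * (b k *+ 'C(n, k))).
  have -> : (if k == 0%N then 0 else b k.-1.+1 *+ 'C(n.+1, k.-1.+1) *+ k.-1.+1)
     = b k *+ 'C(n.+1, k) *+ k by case: (k).
  have [kn|kn] := leqP k n.+1; last first.
    by rewrite (bin_small kn) (bin_small (ltnW kn)) !mulr0n mul0rn mulr0 subr0 oppr0.
  have := mul_bin_down n.+1 k => /(congr1 (fun m => m%:R : R)).
  rewrite !natrM natrB //= => e.
  rewrite -[b k *+ 'C(n, k)]mulr_natr -[b k *+ 'C(n.+1, k)]mulr_natr -[_ *+ k]mulr_natr.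
  rewrite [in RHS]mulrCA e; ring.
rewrite e1 -addrA e2 -mulrBr mulKf ?pnatr_eq0 // -mulrnBl //.
Qed.

Lemma real_complex_diffs b k : diffs (fun k => (b k)%:C%C) k = (diffs b k)%:C%C.
Proof.
rewrite /diffs; elim: k 0%N => //= k IH i.
by rewrite /diff !IH rmorphB.
Qed.

(** By [binsum_diffs] the new polynomial at [z] is [(1 - z)^n] times [jensen n b] at [z/(1 - z)],
    and this Moebius map preserves the upper half-plane. *)
Lemma jensen_rr_diffs b : jensen_rr b -> jensen_rr (diffs b).
Proof.
move=> h n; have [j0|hj] := rr_stable (h n).
  have b0 k : (k <= n)%N -> b k = 0.
    move=> hk; have := coef_jensen n b k; rewrite j0 coef0 => /esym /eqP.
    by rewrite mulrn_eq0 eqn0Ngt bin_gt0 hk /= => /eqP.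
  suff -> : jensen n (diffs b) = 0 by exact: rr0.
  apply: (@map_poly_inj _ _ (real_complex R)); rewrite rmorph0.
  apply/polyP => k; rewrite coef_map coef_jensen coef0 /=.
  have [hk|hk] := leqP k n; last by rewrite bin_small.
  suff -> : diffs b k = 0 by rewrite mul0rn.
  have {}b0 i : (i <= k)%N -> b i = 0 by move=> hi; rewrite b0 // (leq_trans hi).
  rewrite /diffs; have : (0 + k <= k)%N by []; move: {1 3}k 0%N => m.
  elim: m => [|m IH] i hi /=; first by rewrite b0 // -(addn0 i).
  by rewrite /diff !IH ?subrr //; lia.
apply: stable_rr => z hz; rewrite horner_jensen.
rewrite -(eq_binsum _ _ _ (real_complex_diffs b)) binsum_diffs.
have z1 : 1 - z != 0.
  by apply: contraTneq hz => /subr0_eq <-; rewrite /= ltxx.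
have -> : binsum n (fun k => (b k)%:C%C) z (1 - z)
  = (1 - z) ^+ n * (cpoly (jensen n b)).[z / (1 - z)].
  rewrite horner_jensen /binsum mulr_sumr; apply: eq_bigr => k _.
  rewrite expr1n mulr1 mulrnAr; congr (_ *+ _).
  have -> : (1 - z) ^+ n = (1 - z) ^+ (n - k) * (1 - z) ^+ k.
    by rewrite -exprD subnK // -ltnS.
  by rewrite expr_div_n; field; exact: expf_neq0.
rewrite mulf_neq0 ?expf_neq0 // hj //.
rewrite (_ : z / (1 - z) = (1 - z)^-1 - 1); last by field.
rewrite Im_add Im_inv Im_opp /= oppr0 addr0 -mulNr divr_gt0 ?sqnorm_gt0 //.
by case: (z) hz => x y /=; rewrite sub0r opprK.
Qed.

End JensenPolynomials.

(** * Limits of real-rooted polynomials; necessity *)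

Section Limits.
Local Open Scope ring_scope.
Local Bind Scope ring_scope with Rdefinitions.RbaseSymbolsImpl.R.
Local Notation C := R[i].
Local Notation Re := (@complex.Re R).
Local Notation Im := (@complex.Im R).
Local Notation cpoly := (map_poly (real_complex R)).
Implicit Types (u v : nat -> R) (a b : R).

Lemma cv_ext u v a : u =1 v -> Un_cv u a -> Un_cv v a.
Proof. by move=> h hu e he; have [N hN] := hu e he; exists N => n hn; rewrite -h; exact: hN. Qed.

Lemma cv_const a : Un_cv (fun _ => a) a.
Proof.
move=> e he; exists 0%N => n _; rewrite /R_dist.
by rewrite (_ : Rminus a a = 0) ?Rabs_R0 //; exact: Rminus_diag.
Qed.

Lemma cvD u v a b : Un_cv u a -> Un_cv v b -> Un_cv (fun n => u n + v n) (a + b).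
Proof. exact: CV_plus. Qed.

Lemma cvM u v a b : Un_cv u a -> Un_cv v b -> Un_cv (fun n => u n * v n) (a * b).
Proof. exact: CV_mult. Qed.

Lemma cvN u a : Un_cv u a -> Un_cv (fun n => - u n) (- a).
Proof. exact: CV_opp. Qed.

Lemma cvMn u a k : Un_cv u a -> Un_cv (fun n => u n *+ k) (a *+ k).
Proof.
move=> h; rewrite -mulr_natl; apply: (@cv_ext (fun n => k%:R * u n)).
  by move=> n; rewrite mulr_natl.
exact/cvM/h/cv_const.
Qed.

Lemma cvX u a k : Un_cv u a -> Un_cv (fun n => u n ^+ k) (a ^+ k).
Proof.
move=> h; elim: k => [|k IH]; first exact: cv_const.
rewrite exprS; apply: cv_ext (cvM h IH) => n; by rewrite exprS.
Qed.

Lemma cv_sum (I : Type) (r : seq I) (F : I -> nat -> R) (G : I -> R) :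
  (forall i, Un_cv (F i) (G i)) ->
  Un_cv (fun n => \sum_(i <- r) F i n) (\sum_(i <- r) G i).
Proof.
move=> h; elim: r => [|i r IH].
  rewrite big_nil; apply: cv_ext (cv_const _) => n; by rewrite big_nil.
rewrite big_cons; apply: cv_ext (cvD (h i) IH) => n; by rewrite big_cons.
Qed.

Lemma cv_le u v a b : (forall n, u n <= v n) -> Un_cv u a -> Un_cv v b -> a <= b.
Proof.
move=> h hu hv; apply/RleP; apply: Rle_cv_lim hu hv => n; exact/RleP.
Qed.

Lemma cv_unique u a b : Un_cv u a -> Un_cv u b -> a = b.
Proof. exact: UL_sequence. Qed.

Lemma cv_invS : Un_cv (fun n => n.+1%:R^-1) 0.
Proof.
move=> e he; have [N hN] := RinvN_cv he; exists N => n hn; move: (hN n hn).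
by rewrite /= -INRE S_INR -RinvE.
Qed.

Lemma poly0_inj (K : idomainType) (p : {poly K}) (f : nat -> K) :
  injective f -> (forall k, p.[f k] = 0) -> p = 0.
Proof.
move=> finj h; apply/eqP/negP => /negP p0.
have := @max_poly_roots _ p (map f (iota 0 (size p))) p0.
rewrite size_map size_iota ltnn => /(_ _ _)/negP; apply=> //.
  by apply/allP => _ /mapP[k _ ->]; apply/eqP.
by rewrite map_inj_uniq // iota_uniq.
Qed.

Lemma cv_sqnorm (P : nat -> {poly R}) (Q : {poly R}) d (z : C) :
  (forall n, size (P n) <= d)%N -> (size Q <= d)%N ->
  (forall i, Un_cv (fun n => (P n)`_i) Q`_i) ->
  Un_cv (fun n => sqnorm (cpoly (P n)).[z]) (sqnorm (cpoly Q).[z]).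
Proof.
move=> sP sQ h.
have hE (S : {poly R}) : (size S <= d)%N ->
   (cpoly S).[z] = \sum_(i < d) (S`_i)%:C%C * z ^+ i.
  move=> sS; rewrite (@horner_coef_wide _ d) ?size_map_poly //.
  by apply: eq_bigr => i _; rewrite coef_map.
have hRe (S : {poly R}) : (size S <= d)%N -> Re (cpoly S).[z] = \sum_(i < d) S`_i * Re (z ^+ i).
  move=> sS; rewrite hE // (big_morph Re (@Re_add _) (erefl : Re 0 = 0)).
  by apply: eq_bigr => i _; rewrite Re_mul /= mul0r subr0.
have hIm (S : {poly R}) : (size S <= d)%N -> Im (cpoly S).[z] = \sum_(i < d) S`_i * Im (z ^+ i).
  move=> sS; rewrite hE // (big_morph Im (@Im_add _) (erefl : Im 0 = 0)).
  by apply: eq_bigr => i _; rewrite Im_mul /= mul0r addr0.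
apply: (@cv_ext (fun n => (\sum_(i < d) (P n)`_i * Re (z ^+ i)) ^+ 2 +
                          (\sum_(i < d) (P n)`_i * Im (z ^+ i)) ^+ 2)).
  by move=> n; rewrite /sqnorm hRe // hIm.
rewrite /sqnorm hRe // hIm //.
by apply: cvD; apply: cvX; apply: cv_sum => i; apply: cvM (cv_const _).
Qed.

(* [y |-> |P(x + iy)|^2] is nondecreasing on [y >= 0] for real-rooted [P], and this
   passes to the limit; so a zero of the limit off the real axis forces a whole
   segment of zeros. *)
Lemma rr_closed (P : nat -> {poly R}) (Q : {poly R}) d :
  (forall n, rr (P n)) -> (forall n, size (P n) <= d)%N ->
  (forall i, Un_cv (fun n => (P n)`_i) Q`_i) -> rr Q.
Proof.
move=> hP sP h.
have sQ : (size Q <= d)%N.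
  apply/leq_sizeP => j hj; apply: cv_unique (h j) _.
  by apply: cv_ext (cv_const 0) => n; rewrite nth_default // (leq_trans (sP n)).
have cvz z := @cv_sqnorm P Q d z sP sQ h.
apply/rrP; have [->|Q0] := eqVneq Q 0; [by left|right=> z hz; apply/eqP => Qz].
case: z hz Qz => x y /= y0 Qz.
suff Q00 : cpoly Q = 0 by move/eqP: Q00; rewrite map_poly_eq0 (negPf Q0).
apply: (@poly0_inj _ _ (fun k => Complex x (y / k.+1%:R))) => [i j []|k].
  by move=> /(mulfI (lt0r_neq0 y0)) /invr_inj /eqP; rewrite eqr_nat => /eqP[].
apply/eqP; rewrite -sqnorm_eq0 eq_le sqnorm_ge0 andbT.
have -> : 0 = sqnorm (cpoly Q).[Complex x y] by rewrite Qz /sqnorm /= expr0n addr0.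
apply: cv_le (cvz _) (cvz _) => n; apply: rr_sqnorm_homo => //.
rewrite divr_ge0 ?ler0n ?(ltW y0) //= ler_pdivrMr ?ltr0n //.
by rewrite ler_peMr ?(ltW y0) // ler1n.
Qed.

(** * The operator [exp(-D^2)] as a limit *)

Definition binom_ratio n k : R := 'C(n.+1, k)%:R / n.+1%:R ^+ k.

(** These ratios are the coefficients of [(1 + x/N)^N] with [N = n + 1], which tend to those of
    [exp(x)]. *)
Lemma cv_binom_ratio k : Un_cv (fun n => binom_ratio n k) (k`!%:R^-1).
Proof.
have h : Un_cv (fun n => (n.+1 ^_ k)%:R / n.+1%:R ^+ k) 1.
  elim: k => [|k IH].
    by apply: cv_ext (cv_const 1) => n; rewrite ffactn0 expr0 divr1.
  have h1 : Un_cv (fun n => 1 - k%:R * n.+1%:R^-1) 1.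
    rewrite -[X in Un_cv _ X]subr0 -(mulr0 k%:R).
    by apply: cvD (cv_const _) _; apply: cvN; apply: cvM (cv_const _) cv_invS.
  rewrite -[X in Un_cv _ X]mulr1; apply: cv_ext (cvM IH h1) => n.
  have n0 : n.+1%:R != 0 :> R by rewrite pnatr_eq0.
  rewrite ffactnSr natrM; have [kn|kn] := leqP k n.+1.
    rewrite natrB // exprS; move: n0 (expf_neq0 k n0).
    move: (n.+1%:R : R) => t; move: (t ^+ k) => u t0 u0; field.
    by rewrite t0 u0.
  by rewrite ffact_small // !mul0r.
rewrite -[X in Un_cv _ X]mul1r; apply: cv_ext (cvM h (cv_const _)) => n.
rewrite /binom_ratio -bin_ffact natrM mulrAC mulfK //.
by rewrite pnatr_eq0 -lt0n fact_gt0.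
Qed.

Definition heat n : {poly R} := (1 - n.+1%:R^-1 *: 'X^2) ^+ n.+1.

(** Taylor coefficients of [exp(-t^2)], so that [act eps] is [exp(-D^2)]. *)
Definition eps k : R := if odd k then 0 else (-1) ^+ k./2 / (k./2)`!%:R.

Lemma coef_heat n k :
  (heat n)`_k = if odd k then 0 else (-1) ^+ k./2 * binom_ratio n k./2.
Proof.
have -> : heat n = (\poly_(j < n.+2) ((-1) ^+ j * binom_ratio n j)) \Po 'X^2.
  rewrite /heat exprBn poly_def rmorph_sum /=; apply: eq_bigr => j _.
  rewrite linearZ /= rmorphXn /= comp_polyX expr1n mulr1 exprZn /binom_ratio.
  rewrite -exprM -[in LHS]scaler_nat -signr_odd -[in RHS]signr_odd exprVn.
  by case: (odd j); rewrite ?expr0 ?expr1 ?mul1r ?mulN1r ?scaleNr ?scalerN scalerA.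
rewrite coef_comp_poly_Xn // dvdn2 -divn2; case: (odd k) => //=.
rewrite coef_poly; case: ltnP => // h.
by rewrite /binom_ratio bin_small // mulr0n mul0r mulr0.
Qed.

Lemma cv_heat k : Un_cv (fun n => (heat n)`_k) (eps k).
Proof.
rewrite /eps; case: ifP => ok.
  by apply: cv_ext (cv_const 0) => n; rewrite coef_heat ok.
apply: cv_ext (cvM (cv_const _) (cv_binom_ratio _)) => n.
by rewrite coef_heat ok.
Qed.

Lemma cv_act (e : nat -> nat -> R) e' (f : nat -> {poly R}) (f' : {poly R}) d i :
  (forall n, size (f n) <= d)%N -> (size f' <= d)%N ->
  (forall k, Un_cv (e^~ k) (e' k)) -> (forall k, Un_cv (fun n => (f n)`_k) f'`_k) ->
  Un_cv (fun n => (act (e n) (f n))`_i) (act e' f')`_i.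
Proof.
move=> sf sf' he hf; rewrite (@coef_act _ _ _ d) //.
apply: (@cv_ext (fun n => \sum_(k < d) e n k * ((f n)`_(k + i) *+ (k + i) ^_ k))).
  by move=> n; rewrite (@coef_act _ _ _ d).
apply: cv_sum => k; apply: cvM => //; exact: cvMn.
Qed.

(** The symbol [(1 - w^2/N)^N] has only real zeros. Complex coefficients are allowed because
    [rr_wick_sum] applies this to polynomials depending on a complex parameter. *)
Lemma heat_stable n (f : {poly C}) :
  stable f -> stable (act (fun k => (cpoly (heat n))`_k) f).
Proof.
move=> hf; apply: act_stable => // [w hw|]; last first.
  exists 0%N; first by rewrite size_poly_gt0 stable_neq0.
  have -> : (cpoly (heat n))`_0 = (1 : R)%:C%C.
    rewrite coef_map; congr (_%:C)%C; rewrite /= coef_heat /binom_ratio /= bin0.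
    by rewrite !expr0 mul1r divr1.
  by rewrite rmorph1 oner_neq0.
have -> : (cpoly (heat n)).[w] = (1 - (n.+1%:R^-1)%:C%C * w ^+ 2) ^+ n.+1.
  by rewrite rmorphXn rmorphB rmorph1 /= map_polyZ map_polyXn !hornerE.
rewrite expf_neq0 // subr_eq0; apply/eqP => h.
have t0 : 0 < n.+1%:R^-1 :> R by rewrite invr_gt0 ltr0n.
move: h; move: (n.+1%:R^-1 : R) t0 => t t0; case: w hw => x y /= y0 h.
have := congr1 Im h; have := congr1 Re h => /=.
rewrite !mul0r subr0 addr0 => h1 h2.
have x0 : x = 0.
  have : t * (x * y) = 0 by lra.
  move=> /eqP; rewrite !mulf_eq0 (gt_eqF t0) (lt_eqF y0) orbF => /eqP //.
have y2 : 0 < y * y by nra.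
by move: h1; rewrite x0; have := mulr_gt0 t0 y2; lra.
Qed.

Lemma rr_heat n P : rr P -> rr (act (fun k => (heat n)`_k) P).
Proof.
move=> /rr_stable[->|hP]; first by rewrite act0; exact: rr0.
apply: stable_rr; rewrite map_act.
have := heat_stable n hP; congr stable; apply: eq_act => k _.
by rewrite coef_map.
Qed.

Lemma rr_eps P : rr P -> rr (act eps P).
Proof.
move=> hP; apply: (@rr_closed (fun n => act (fun k => (heat n)`_k) P) _ (size P)).
- by move=> n; exact: rr_heat.
- by move=> n; exact: size_act.
move=> i; apply: (@cv_act (fun n k => (heat n)`_k) eps (fun=> P) P (size P)) => // k.
  exact: cv_heat.
exact: cv_const.
Qed.

(** * Multiplier operators *)

Definition mult (lam : nat -> R) (q : {poly R}) : {poly R} := \poly_(i < size q) (lam i * q`_i).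

Lemma coef_mult lam q i : (mult lam q)`_i = lam i * q`_i.
Proof. by rewrite coef_poly; case: ltnP => // h; rewrite nth_default // mulr0. Qed.

Lemma size_mult lam q : (size (mult lam q) <= size q)%N.
Proof. exact: size_poly. Qed.

Definition rr_mult lam := forall q, rr q -> rr (mult lam q).

(** Quantifying over the preimage [q] expresses the condition on [E Lam E^-1] without naming the
    inverse of [E]. *)
Definition rr_eps_mult lam := forall q, rr (act eps q) -> rr (act eps (mult lam q)).

Lemma eps0 : eps 0 = 1.
Proof. by rewrite /eps /= expr0 divr1. Qed.

Lemma coef_comp_scale (a : R) (P : {poly R}) i : (P \Po (a *: 'X))`_i = a ^+ i * P`_i.
Proof.
rewrite coef_comp_poly; under eq_bigr => k _ do rewrite exprZn coefZ coefXn.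
have [h|h] := ltnP i (size P).
  rewrite (bigD1 (Ordinal h)) //= eqxx mulr1 big1 ?addr0 1?mulrC // => k hk.
  rewrite (_ : (i == k) = false) ?mulr0 //; apply: contraNF hk => /eqP e.
  exact/eqP/val_inj.
rewrite nth_default // mulr0 big1 // => k _.
by rewrite gtn_eqF ?mulr0 // (leq_trans _ h).
Qed.

(* The dilation [q(x) |-> q(sx)] conjugates [exp(-D^2)] to [exp(-s^2 D^2)], which
   tends to the identity as [s] tends to [0]. *)
Lemma rr_eps_mult_rr_mult lam : rr_eps_mult lam -> rr_mult lam.
Proof.
move=> hl q hq.
pose s n : R := n.+1%:R^-1.
have s0 n : 0 < s n by rewrite invr_gt0 ltr0n.
pose P n := act eps (mult lam (q \Po (s n *: 'X))) \Po ((s n)^-1 *: 'X).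
have sz n : (size (mult lam (q \Po (s n *: 'X))) <= size q)%N.
  apply: leq_trans (size_mult _ _) _; apply/leq_sizeP => j hj.
  by rewrite coef_comp_scale nth_default ?mulr0.
apply: (@rr_closed P _ (size q)).
- move=> n; apply: rr_comp_scale; first by rewrite invr_gt0.
  by apply/hl/rr_eps/rr_comp_scale.
- move=> n; apply/leq_sizeP => j hj.
  rewrite coef_comp_scale nth_default ?mulr0 //.
  exact: leq_trans (leq_trans (size_act _ _) (sz n)) hj.
move=> i; rewrite coef_mult.
(* The limit is written as a sum in which only [k = 0] survives, matching termwise the factors [s^k]
   of the approximants. *)
have -> : lam i * q`_i =
  \sum_(k < (size q).+1)
     eps k * (lam (k + i)%N * ((k == 0%N :> nat)%:R * q`_(k + i)) *+ (k + i) ^_ k).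
  rewrite big_ord_recl /= eps0 !mul1r add0n ffactn0 mulr1n big1 ?addr0 // => k _.
  by rewrite /bump leq0n add1n /= mul0r mulr0 mul0rn mulr0.
apply: (@cv_ext (fun n => \sum_(k < (size q).+1)
    eps k * (lam (k + i)%N * (s n ^+ k * q`_(k + i)) *+ (k + i) ^_ k))).
  move=> n; rewrite coef_comp_scale (@coef_act _ _ _ (size q).+1) ?(leq_trans (sz n)) //.
  rewrite mulr_sumr; apply: eq_bigr => k _; rewrite coef_mult coef_comp_scale.
  rewrite exprD [RHS]mulrCA; congr (_ * _); rewrite mulrnAr; congr (_ *+ _).
  move: (s n) (s0 n) => t t0; have : t ^+ i != 0 by rewrite expf_neq0 ?gt_eqF.
  by rewrite exprVn; move: (t ^+ i) (t ^+ k) => u v u0; field.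
apply: cv_sum => k; apply: cvM (cv_const _) _; apply: cvMn; apply: cvM (cv_const _) _.
apply: cvM _ (cv_const _); case: (nat_of_ord k) => [|m].
  by apply: cv_ext (cv_const 1) => n; rewrite expr0.
by rewrite /= -[X in Un_cv _ X](expr0n R m.+1); apply: cvX; exact: cv_invS.
Qed.

(** Easy half of the Polya-Schur characterization: the Jensen polynomial is the image of
    [(1 + X)^n]. *)
Lemma rr_mult_jensen lam : rr_mult lam -> jensen_rr lam.
Proof.
move=> h n; have -> : jensen n lam = mult lam ((1 + 'X) ^+ n).
  apply/polyP => k; rewrite coef_jensen coef_mult exprDn coef_sum.
  rewrite -mulr_natr; congr (_ * _).
  under eq_bigr => j _ do rewrite expr1n mul1r coefMn coefXn.
  have [hk|hk] := ltnP k n.+1.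
    rewrite (bigD1 (Ordinal hk)) //= eqxx big1 ?addr0 // => j hj.
    rewrite (_ : (k == j) = false) ?mul0rn //; apply: contraNF hj => /eqP e.
    exact/eqP/val_inj.
  rewrite bin_small // big1 // => j _.
  by rewrite gtn_eqF ?mul0rn // (leq_trans _ hk).
apply/h/rrX; rewrite addrC -[X in _ + X]opprK -polyC1 -polyCN; exact: rr_XsubC.
Qed.

(** * Coefficient inequalities and monotonicity of Hermite multipliers *)

Lemma jensen_rr_shifts (b : nat -> R) m : jensen_rr b -> jensen_rr (fun i => b (m + i)%N).
Proof. by elim: m b => // m IH b h; exact: (IH _ (jensen_rr_shift h)). Qed.

(** Discriminant of the quadratic Jensen polynomial of the shifted sequence. *)
Lemma jensen_log_concave (b : nat -> R) m : jensen_rr b -> b m * b m.+2 <= b m.+1 ^+ 2.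
Proof.
move=> h; have := rr_quadratic (jensen_rr_shifts m h 2%N) (size_jensen _ _).
rewrite !coef_jensen bin0 bin1 binn !mulr1n mulr2n addn0 addn1 addn2; lra.
Qed.

Lemma jensen_no_gap (b : nat -> R) i j k : jensen_rr b -> (forall n, 0 <= b n) ->
  (i <= j <= k)%N -> 0 < b i -> 0 < b k -> 0 < b j.
Proof.
move=> h b0 /andP[ij jk] bi bk.
have c n : (jensen (k - i) (fun m => b (i + m)%N))`_n = b (i + n)%N *+ 'C(k - i, n).
  exact: coef_jensen.
have := @rr_no_gap _ _ (j - i)%N (k - i)%N (jensen_rr_shifts i h (k - i)%N).
rewrite !c !subnKC // ?(leq_trans ij) // addn0 !pmulrn_lgt0 ?bin_gt0 ?leq_sub2r //.
by apply=> // n; rewrite c mulrn_wge0.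
Qed.

(** The size bound leaves only the orders 0, 2 and 4 of [exp(-D^2)], with weights 1, -1 and 1/2. *)
Lemma coef_act_eps (q : {poly R}) n : (size q <= n + 5)%N ->
  (act eps q)`_n = q`_n - (n.+2 * n.+1)%:R * q`_n.+2
                   + (n.+4 * n.+3 * n.+2 * n.+1)%:R / 2 * q`_n.+4.
Proof.
move=> h; rewrite (@coef_act _ _ _ (n + 5)%N) // -(big_mkord xpredT
   (fun k => eps k * (q`_(k + n) *+ (k + n) ^_ k))).
rewrite (@big_cat_nat _ _ _ 5) //=; last by rewrite leq_addl.
rewrite [X in _ + X]big_nat_cond [X in _ + X]big1 ?addr0; last first.
  move=> k /andP[/andP[hk _] _]; rewrite [q`__]nth_default ?mul0rn ?mulr0 //.
  by rewrite (leq_trans h) // addnC leq_add2r.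
rewrite !big_nat_recl // big_geq // /eps /= !mul0r !add0r !addr0.
rewrite add0n ffactn0 !add2n !addSn add0n.
have -> : n.+2 ^_ 2 = (n.+2 * n.+1)%N by rewrite !ffactSS ffactn0 muln1.
have -> : n.+4 ^_ 4 = (n.+4 * n.+3 * n.+2 * n.+1)%N by rewrite !ffactSS ffactn0 muln1 !mulnA.
rewrite -[q`_n.+2 *+ _]mulr_natr -[q`_n.+4 *+ _]mulr_natr.
rewrite expr0 expr1 sqrrN expr1n !factS fact0; by field.
Qed.

(** [exp(-D^2)] is unitriangular on monomials: the top term is its own leading preimage, and the
    remainder has smaller size. *)
Lemma act_eps_surj n (f : {poly R}) : (size f <= n)%N ->
  exists2 q : {poly R}, (size q <= n)%N & act eps q = f.
Proof.
elim: n f => [|n IH] f sf.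
  exists 0; first by rewrite size_poly0.
  by rewrite act0; apply/esym/eqP; rewrite -size_poly_leq0.
have sX : (size (f`_n *: 'X^n : {poly R}) <= n.+1)%N.
  by apply: leq_trans (size_scale_leq _ _) _; rewrite size_polyXn.
have [|q sq hq] := IH (f - act eps (f`_n *: 'X^n)).
  apply/leq_sizeP => j; rewrite leq_eqVlt => /orP[/eqP <-|nj].
    rewrite coefB (@coef_act _ _ _ n.+1) // big_ord_recl /= eps0 ffactn0 mul1r.
    rewrite add0n mulr1n coefZ coefXn eqxx mulr1 big1 ?addr0 ?subrr // => k _.
    by rewrite /bump leq0n add1n coefZ coefXn gtn_eqF ?mulr0 ?mul0rn ?mulr0 // addSn ltnS leq_addl.
  rewrite nth_default // (leq_trans (size_polyD _ _)) // geq_max size_polyN.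
  by rewrite (leq_trans sf) // (leq_trans (size_act _ _)) // (leq_trans sX).
exists (q + f`_n *: 'X^n); last by rewrite actD hq subrK.
by rewrite (leq_trans (size_polyD _ _)) // geq_max sX leqW.
Qed.

(** Differentiating [n] times leaves a real-rooted quadratic without linear term. *)
Lemma rr_two_coefs (Q : {poly R}) n : rr Q -> (size Q <= n.+3)%N -> Q`_n.+1 = 0 ->
  Q`_n * Q`_n.+2 <= 0.
Proof.
move=> hQ sQ Q1; have := rr_quadratic (rr_derivn n hQ).
rewrite !coef_derivn addn0 addn1 addn2 Q1 mul0rn expr0n /= => h.
have {}h : 4 * (Q`_n *+ n ^_ n) * (Q`_n.+2 *+ n.+2 ^_ n) <= 0.
  apply: h; apply/leq_sizeP => j hj; rewrite coef_derivn nth_default ?mul0rn //.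
  by rewrite (leq_trans sQ) // -addn3 leq_add2l.
move: h; rewrite -[Q`_n *+ _]mulr_natr -[Q`_n.+2 *+ _]mulr_natr.
have f1 : 0 < (n ^_ n)%:R :> R by rewrite ltr0n ffact_gt0.
have f2 : 0 < (n.+2 ^_ n)%:R :> R by rewrite ltr0n ffact_gt0; lia.
move: ((n ^_ n)%:R : R) ((n.+2 ^_ n)%:R : R) f1 f2 => x y x0 y0.
have -> : 4 * (Q`_n * x) * (Q`_n.+2 * y) = (4 * x * y) * (Q`_n * Q`_n.+2) by ring.
by rewrite pmulr_rle0 // !mulr_gt0.
Qed.

Lemma rr_polyX : rr ('X : {poly R}).
Proof. by rewrite -['X]subr0; exact: rr_XsubC. Qed.

(* Applied to [x^(n+2)], the operator yields leading coefficients
   [lam_(n+2)], [0], [(n+2)(n+1)(lam_n - lam_(n+2))]. *)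
Lemma eps_mult_step2 (lam : nat -> R) n :
  rr_eps_mult lam -> 0 < lam n.+2 -> lam n <= lam n.+2.
Proof.
move=> hlam l2.
have sX : (size ('X^(n.+2) : {poly R}) <= n.+3)%N by rewrite size_polyXn.
have [q sq hq] := act_eps_surj sX.
have hr : rr (act eps (mult lam q)) by apply: hlam; rewrite hq; exact/rrX/rr_polyX.
have q0 j : (n.+3 <= j)%N -> q`_j = 0.
  by move=> hj; rewrite nth_default // (leq_trans sq).
(* Downward recursion for the coefficients of the preimage of the test polynomial, solved from the
   top. *)
have e i : (n <= i)%N -> q`_i = (i == n.+2)%:R + (i.+2 * i.+1)%:R * q`_i.+2
     - (i.+4 * i.+3 * i.+2 * i.+1)%:R / 2 * q`_i.+4.
  move=> hi; have := @coef_act_eps q i; rewrite hq coefXn => -> //; last by lia.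
  ring.
have c2 : q`_n.+2 = 1 by rewrite e ?eqxx ?q0 ?mulr0 ?subr0 ?addr0 //; lia.
have c1 : q`_n.+1 = 0 by rewrite e ?q0 ?mulr0 ?subr0 ?addr0 //= ?ltn_eqF //; lia.
have c0 : q`_n = (n.+2 * n.+1)%:R.
  rewrite e // c2 q0 ?mulr0 ?mulr1 ?subr0 ?ltn_eqF ?add0r //; lia.
have sm : (size (mult lam q) <= n.+3)%N by exact: leq_trans (size_mult _ _) sq.
have sa : (size (act eps (mult lam q)) <= n.+3)%N by exact: leq_trans (size_act _ _) sm.
have m0 j : (n.+3 <= j)%N -> (mult lam q)`_j = 0 by move=> hj; rewrite coef_mult q0 ?mulr0.
have := rr_two_coefs hr sa; rewrite !coef_act_eps; try lia.
rewrite !(m0 n.+3) // !(m0 n.+4) // ?(m0 n.+4.+1) // ?(m0 n.+4.+2) //; try lia.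
rewrite !coef_mult c0 c1 c2 !mulr0 !subr0 !addr0 !mulr1 => /(_ erefl).
have p0 : 0 < (n.+2 * n.+1)%:R :> R by rewrite ltr0n.
rewrite pmulr_lle0 // [lam n * _]mulrC -mulrBr pmulr_rle0 // subr_le0 //.
Qed.

(* Tested on [x^(n+4) - s x^(n+2)] with [s] slightly above [(n+4)(n+3)]: its
   coordinate on the Hermite polynomial of degree [n+2] is small and has the same
   sign as the one of degree [n]. *)
Lemma eps_mult_no_stop (lam : nat -> R) n : rr_eps_mult lam ->
  0 < lam n -> 0 < lam n.+2 -> lam n.+3 = 0 -> lam n.+4 = 0 -> False.
Proof.
move=> hlam l0 l2 l3 l4.
pose c : R := (n.+4 * n.+3)%:R; pose b : R := (n.+2 * n.+1)%:R.
(* With this [d] the preimage has coefficient [-d] at degree [n+2], which the multiplier sends to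
   [-lam n]. Both surviving coefficients are then negative, since [d + c/2 > 1], and [rr_two_coefs]
   is contradicted. *)
pose d := lam n / lam n.+2; have d0 : 0 < d by rewrite divr_gt0.
have b0 : 0 < b by rewrite ltr0n.
have c2 : 2 <= c by rewrite ler_nat; lia.
pose p : {poly R} := 'X^(n.+2) * ('X^2 - (c + d)%:P).
have pE i : p`_i = (i == n.+4)%:R - (c + d) * (i == n.+2)%:R.
  rewrite /p mulrBr -exprD addn2 coefB coefXn mulrC mul_polyC coefZ coefXn //.
have sp : (size p <= n.+4.+1)%N.
  apply/leq_sizeP => j hj; rewrite pE !gtn_eqF ?mulr0 ?subr0 //; lia.
have rp : rr p.
  apply: rrM; first exact/rrX/rr_polyX.
  have -> : 'X^2 - (c + d)%:P = ('X - (Num.sqrt (c + d))%:P) * ('X - (- Num.sqrt (c + d))%:P).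
    rewrite polyCN opprK -subr_sqr -polyC_exp sqr_sqrtr //; lra.
  by apply: rrM; exact: rr_XsubC.
have [q sq hq] := act_eps_surj sp.
have hr : rr (act eps (mult lam q)) by apply: hlam; rewrite hq.
have q0 j : (n.+4.+1 <= j)%N -> q`_j = 0.
  by move=> hj; rewrite nth_default // (leq_trans sq).
have e i : (n <= i)%N -> q`_i = p`_i + (i.+2 * i.+1)%:R * q`_i.+2
     - (i.+4 * i.+3 * i.+2 * i.+1)%:R / 2 * q`_i.+4.
  move=> hi; have := @coef_act_eps q i; rewrite hq => -> //; last by lia.
  ring.
have E2 : (n.+2 == n.+4) = false by lia.
have E0 : (n == n.+4) = false by lia.
have E02 : (n == n.+2) = false by lia.
have E42 : (n.+4 == n.+2) = false by lia.
have E3 : (n.+3 == n.+4) = false by lia.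
have E32 : (n.+3 == n.+2) = false by lia.
have E1 : (n.+1 == n.+4) = false by lia.
have E12 : (n.+1 == n.+2) = false by lia.
have q4 : q`_n.+4 = 1 by rewrite e ?pE ?eqxx ?E42 ?q0 ?mulr0 ?subr0 ?addr0 //; lia.
have q3 : q`_n.+3 = 0 by rewrite e ?pE ?E3 ?E32 ?q0 ?mulr0 ?subr0 ?addr0 //; lia.
have q2 : q`_n.+2 = - d.
  rewrite e ?pE ?q4 ?E2 ?eqxx ?(q0 n.+4.+2) //; last by lia.
  rewrite /= mulr0n mulr1n -/c; ring.
have q1 : q`_n.+1 = 0.
  rewrite e ?pE ?q3 ?E1 ?E12 ?(q0 n.+4.+1) //= !mulr0n; ring.
have qn : q`_n = - (b * d) - c * b / 2.
  rewrite e // pE q2 q4 E0 E02 /= mulr0n -/b.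
  have -> : (n.+4 * n.+3 * n.+2 * n.+1)%:R = c * b by rewrite -mulnA natrM.
  ring.
have m0 j : (n.+3 <= j)%N -> (mult lam q)`_j = 0.
  rewrite coef_mult leq_eqVlt => /orP[/eqP <-|]; first by rewrite l3 mul0r.
  rewrite leq_eqVlt => /orP[/eqP <-|hj]; first by rewrite l4 mul0r.
  by rewrite q0 ?mulr0.
have sm : (size (mult lam q) <= n.+3)%N by apply/leq_sizeP => j /m0.
have sa : (size (act eps (mult lam q)) <= n.+3)%N by exact: leq_trans (size_act _ _) sm.
have := rr_two_coefs hr sa; rewrite !coef_act_eps; try lia.
rewrite !(m0 n.+3) // !(m0 n.+4) // ?(m0 n.+4.+1) // ?(m0 n.+4.+2) //; try lia.
rewrite !coef_mult qn q1 q2 !mulr0 !subr0 !addr0 => /(_ erefl) /=.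
have -> : lam n.+2 * - d = - lam n by rewrite /d; field; rewrite gt_eqF.
rewrite -/b => h.
have : 0 < b * lam n * (lam n * (d + c / 2 - 1)).
  by rewrite !mulr_gt0 //; lra.
lra.
Qed.

(** If two nonzero terms are adjacent, a third one outside the pair is at distance at least two from
    one of them. *)
Lemma two_far_terms (lam : nat -> R) : ~ (exists k, forall n, n <> k -> n <> k.+1 -> lam n = 0) ->
  exists i j, [/\ (i.+2 <= j)%N, lam i <> 0 & lam j <> 0].
Proof.
move=> ht.
have far k : exists n, [/\ n <> k, n <> k.+1 & lam n <> 0].
  apply: NNPP => h; apply: ht; exists k => n h1 h2; apply: NNPP => h3.
  by apply: h; exists n.
have [i0 [_ _ li]] := far 0%N.
have [j [j1 j2 lj]] := far i0.
have [h|h] := leqP i0.+2 j; first by exists i0, j.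
have [h'|h'] := leqP j.+2 i0; first by exists j, i0.
have ej : i0 = j.+1 by lia.
have [l [l1 l2 ll]] := far j.
have [h3|h3] := leqP j.+2 l; first by exists j, l.
by exists l, i0; split=> //; lia.
Qed.

Lemma eps_mult_nondecreasing (lam : nat -> R) :
  ~ (exists k, forall n, n <> k -> n <> k.+1 -> lam n = 0) ->
  (forall n, 0 <= lam n) -> rr_eps_mult lam -> forall n, lam n <= lam n.+1.
Proof.
move=> ht l0 hl n; have hj := rr_mult_jensen (rr_eps_mult_rr_mult hl).
have pos m : lam m <> 0 -> 0 < lam m by move=> /eqP h; rewrite lt_def h l0.
have [i [j [ij /pos li /pos lj]]] := two_far_terms ht.
have gap (a b c : nat) : (a <= b <= c)%N -> 0 < lam a -> 0 < lam c -> 0 < lam b.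
  exact: jensen_no_gap.
have zero m : ~~ (0 < lam m) -> lam m = 0.
  by rewrite lt_def l0 andbT negbK => /eqP.
(* Positivity propagates forever: a first zero would, by absence of gaps, be followed by another
   zero, which [eps_mult_no_stop] forbids. *)
have l2 m : 0 < lam (i.+2 + m)%N.
  elim: m => [|m IH]; first by rewrite addn0 (gap i _ j) // ij !leqW.
  have lm : 0 < lam (i + m)%N by rewrite (gap i _ (i.+2 + m)%N) //; lia.
  apply/negPn/negP => /zero h3; rewrite addnS in h3.
  apply: (eps_mult_no_stop hl lm IH h3); apply: zero; apply/negP => h4.
  by have := gap _ _ _ _ IH h4; move=> /(_ (i + m).+3); rewrite h3 ltxx; move/(_ _)/negP; lia.
have [->//|/eqP ln] := eqVneq (lam n) 0; have {}ln := pos _ ln.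
have ln1 : 0 < lam n.+1 by apply: gap ln (l2 n.+1); lia.
have ln2 : 0 < lam n.+2 by apply: gap ln (l2 n.+2); lia.
(* Together, [lam n ^ 2 <= lam n * lam n.+2 <= lam n.+1 ^ 2]. *)
have h1 := eps_mult_step2 hl ln2; have h2 := jensen_log_concave n hj.
rewrite leNgt; apply/negP => h3; nra.
Qed.

End Limits.

(** * Sufficiency *)

Section Sufficiency.
Local Open Scope ring_scope.
Local Bind Scope ring_scope with Rdefinitions.RbaseSymbolsImpl.R.
Local Notation C := R[i].
Local Notation Re := (@complex.Re R).
Local Notation Im := (@complex.Im R).
Local Notation cpoly := (map_poly (real_complex R)).

Lemma cv_shift (u : nat -> R) a : Un_cv u a -> Un_cv (fun n => u n.+1) a.
Proof.
by move=> h e he; have [N hN] := h e he; exists N => n hn; apply: hN; exact: le_S.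
Qed.

Lemma cv_decreasing (u : nat -> R) :
  (forall n, 0 <= u n) -> (forall n, u n.+1 <= u n) -> exists a, Un_cv u a.
Proof.
move=> u0 ud; have [|| a ha] := @decreasing_cv u.
- by move=> n; apply/RleP.
- exists 0 => _ [n ->]; apply/RleP; rewrite /opp_seq; change (- u n <= 0).
  by rewrite oppr_le0.
by exists a.
Qed.

(* If some difference decreases, log-concavity makes the differences decay with
   ratios tending to some [rho < 1]; then [b] behaves like [L - rho^n], for which
   the cubic discriminant inequality reads [(1 - rho)^4 <= 0] in the limit. *)
Lemma jensen_convex (b : nat -> R) : jensen_rr b -> (forall n, 0 <= b n) ->
  (forall n, b n <= b n.+1) -> forall n, diff b n <= diff b n.+1.
Proof.
move=> hj b0 bm n; rewrite leNgt; apply/negP => dn.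
have hd := jensen_rr_diff hj; set d := diff b in dn hd *.
have d0 m : 0 <= d m by rewrite subr_ge0.
have bS m : b m.+1 = b m + d m by rewrite /d /diff addrC subrK.
have cubic m : (b m.+1 * b m.+2 - b m * b m.+3) ^+ 2 <=
    4 * (b m.+1 ^+ 2 - b m * b m.+2) * (b m.+2 ^+ 2 - b m.+1 * b m.+3).
  apply: (rr_cubic (jensen_rr_shifts m hj 3%N) (size_jensen _ _)); rewrite coef_jensen.
  - by rewrite bin0 mulr1n addn0.
  - by rewrite bin1 addn1 mulr_natl.
  - by rewrite addn2 (_ : 'C(3, 2) = 3%N) // mulr_natl.
  - by rewrite binn mulr1n addn3.
have dd k : d (n + k).+1 < d (n + k)%N.
  elim: k => [|k IH]; first by rewrite addn0.
  rewrite addnS; move: (n + k)%N IH => m IH.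
  have lc := jensen_log_concave m hd; have dm0 : 0 < d m by exact: le_lt_trans IH.
  have [d1|d1] := ltP 0 (d m.+1).
    rewrite -(ltr_pM2l dm0); apply: le_lt_trans lc _.
    by rewrite expr2 ltr_pM2r.
  (* If the differences reached zero they would stay zero once more, and with [x = b m], [y = d m]
     the cubic inequality would read [((x + y) y)^2 <= 0]. *)
  have d1e : d m.+1 = 0 by apply: le_anti; rewrite d1 d0.
  have d2e : d m.+2 = 0.
    apply: le_anti; rewrite d0 andbT -(ler_pM2l dm0) mulr0 (le_trans lc) //.
    by rewrite d1e expr0n.
  have := cubic m; rewrite (bS m.+2) (bS m.+1) d1e d2e (bS m) !addr0.
  have := b0 m; move: (b m) (d m) dm0 => x y y0 x0 h.
  have : 0 < ((x + y) * y) ^+ 2 by rewrite exprn_gt0 // mulr_gt0 //; lra.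
  by move: h; nra.
have dp k : 0 < d (n + k)%N by exact: le_lt_trans (dd k).
pose p k := d (n + k).+1 / d (n + k)%N.
have p0 k : 0 <= p k by rewrite divr_ge0.
have pE k : d (n + k).+1 = p k * d (n + k)%N by rewrite divfK // gt_eqF.
have pm k : p k.+1 <= p k.
  rewrite /p ler_pdivrMr // mulrAC ler_pdivlMr // !addnS mulrC.
  by have := jensen_log_concave (n + k) hd; rewrite expr2.
have p1 : p 0%N < 1 by rewrite /p ltr_pdivrMr // mul1r dd.
have [rho hrho] := cv_decreasing p0 pm.
have rho0 : 0 <= rho by apply: cv_le (cv_const 0) hrho.
have rho1 : rho < 1.
  apply: le_lt_trans p1; apply: cv_le hrho (cv_const _) => k.
  by elim: k => // k IH; exact: le_trans (pm k) IH.
have [dl hdl] : exists a, Un_cv (fun k => d (n + k)%N) a.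
  by apply: cv_decreasing => k //; rewrite addnS ltW.
have dl0 : dl = 0.
  have h := cvM hrho hdl.
  have h' : Un_cv (fun k => p k * d (n + k)%N) dl.
    by apply: cv_ext (cv_shift hdl) => k; rewrite addnS pE.
  have := cv_unique h h' => e; have : (1 - rho) * dl = 0 by rewrite mulrBl e mul1r subrr.
  by move=> /eqP; rewrite mulf_eq0 subr_eq0 gt_eqF //= => /eqP.
have bp k : 0 < b (n + k).+1 by rewrite bS ltr_wpDl.
(* The reciprocals converge whether or not [b] is bounded; this suffices for [e] to tend to 0. *)
have [be hbe] : exists a, Un_cv (fun k => (b (n + k).+1)^-1) a.
  apply: cv_decreasing => k; first by rewrite invr_ge0.
  by rewrite lef_pV2 ?posrE // addnS.
pose e k := d (n + k).+1 / b (n + k).+1.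
have he : Un_cv e 0.
  rewrite -(mul0r be) -dl0; apply: cvM hbe.
  by apply: cv_ext (cv_shift hdl) => k; rewrite addnS.
(* The cubic inequality at [n + k], divided by [(d (n + k) * b (n + k).+1)^2]. *)
have key k : (1 - p k * p k.+1 + e k * (1 + p k.+1)) ^+ 2 <=
    4 * (1 - p k + e k) * (p k * (1 - p k.+1 + e k)).
  have := cubic (n + k)%N; have := pE k.+1; rewrite addnS => d2E.
  have d1E : d (n + k).+1 = e k * b (n + k).+1 by rewrite divfK // gt_eqF.
  have b0E : b (n + k)%N = b (n + k).+1 - d (n + k)%N by rewrite bS addrK.
  rewrite (bS (n + k).+2) (bS (n + k).+1) d2E b0E.
  have := pE k; rewrite d1E => pE'.
  have xy : 0 < (d (n + k)%N * b (n + k).+1) ^+ 2 by rewrite exprn_gt0 // mulr_gt0.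
  move: (p k) (p k.+1) (e k) (b (n + k).+1) (d (n + k)%N) pE' xy => P Q E x y h xy.
  move=> H; rewrite -(ler_pM2l xy).
  have a1 : x * (x + E * x) - (x - y) * (x + E * x + Q * (E * x))
            = y * x * (1 - P * Q + E * (1 + Q)).
    transitivity (y * x * (1 + E * (1 + Q)) - Q * (E * x) * x); first by ring.
    by rewrite h; ring.
  have a2 : x ^+ 2 - (x - y) * (x + E * x) = y * x * (1 - P + E).
    transitivity (y * x * (1 + E) - (E * x) * x); first by ring.
    by rewrite h; ring.
  have a3 : (x + E * x) ^+ 2 - x * (x + E * x + Q * (E * x)) = P * y * x * (1 - Q + E).
    by rewrite -h; ring.
  move: H; rewrite a1 a2 a3; lra.
(* In the limit [(1 - rho^2)^2 <= 4 rho (1 - rho)^2], that is [(1 - rho)^4 <= 0]. *)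
have lim := cv_le key
  (cvX 2 (cvD (cvD (cv_const 1) (cvN (cvM hrho (cv_shift hrho))))
              (cvM he (cvD (cv_const 1) (cv_shift hrho)))))
  (cvM (cvM (cv_const 4) (cvD (cvD (cv_const 1) (cvN hrho)) he))
       (cvM hrho (cvD (cvD (cv_const 1) (cvN (cv_shift hrho))) he))).
have : 0 < (1 - rho) ^+ 4 by rewrite exprn_gt0 // subr_gt0.
move: lim; rewrite mul0r !addr0; lra.
Qed.

(** The hypotheses pass from a sequence to its difference: monotonicity makes the difference
    nonnegative, and [jensen_convex] makes it nondecreasing. *)
Lemma diffs_ge0 (b : nat -> R) : jensen_rr b -> (forall n, 0 <= b n) ->
  (forall n, b n <= b n.+1) -> forall k, 0 <= diffs b k.
Proof.
move=> hj b0 bm k; rewrite /diffs.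
have : [/\ jensen_rr (iter k (@diff R) b), forall n, 0 <= iter k (@diff R) b n &
          forall n, iter k (@diff R) b n <= iter k (@diff R) b n.+1].
  elim: k => [|k [h1 h2 h3]] //=; split; first exact: jensen_rr_diff.
    by move=> n; rewrite subr_ge0.
  exact: jensen_convex.
by case.
Qed.

(** * Normally ordered operators, derivatives placed on the right *)

Lemma act_suml (F : fieldType) (I : Type) (r : seq I) (G : I -> {poly F}) (f : {poly F}) :
  act (fun k => (\sum_(i <- r) G i)`_k) f = \sum_(i <- r) act (fun k => (G i)`_k) f.
Proof.
elim: r => [|i r IH].
  by rewrite !big_nil /act big1 // => k _; rewrite polyseq0 nth_nil scale0r.
rewrite !big_cons -IH -actDl; apply: eq_act => k _; exact: coefD.
Qed.

Lemma act_Xn (F : fieldType) n (f : {poly F}) : act (fun k => ('X^n : {poly F})`_k) f = f^`(n).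
Proof.
rewrite (@act_bound _ _ f (size f + n.+1)) ?leq_addr //.
have h : (n < size f + n.+1)%N by rewrite addnS ltnS leq_addl.
rewrite (bigD1 (Ordinal h)) //= coefXn eqxx scale1r big1 ?addr0 // => k hk.
rewrite coefXn (_ : (_ == _) = false) ?scale0r //; apply: contraNF hk => /eqP e.
exact/eqP/val_inj.
Qed.

Lemma act_derivn (F : fieldType) e n (f : {poly F}) : act e f^`(n) = (act e f)^`(n).
Proof. by elim: n => // n IH; rewrite !derivnS act_deriv IH. Qed.

(* [e(D_x) (x - 2w)^k w^k] with [w] acting on [p] as differentiation. *)
Definition wick e k (p : {poly R}) : {poly R} :=
  \sum_(m < k.+1) ('C(k, m)%:R * (-2) ^+ m) *: (act e 'X^(k - m) * p^`(m + k)).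

Definition wick_sum (g e : nat -> R) n (p : {poly R}) := \sum_(k < n) g k *: wick e k p.

Lemma wick_eq0 e k (p : {poly R}) : (size p <= k)%N -> wick e k p = 0.
Proof.
move=> h; apply: big1 => m _; rewrite derivn_eq0 ?mulr0 ?scaler0 //.
by rewrite (leq_trans h) // leq_addl.
Qed.

Lemma wick_sum_bound g e n (p : {poly R}) : (size p <= n)%N ->
  wick_sum g e n p = wick_sum g e (size p) p.
Proof.
move=> h; rewrite /wick_sum -!(big_mkord xpredT (fun k => g k *: wick e k p)).
rewrite (big_cat_nat (leq0n _) h) /= -[RHS]addr0; congr (_ + _).
rewrite big_nat_cond big1 // => k /andP[/andP[hk _] _].
by rewrite wick_eq0 ?scaler0.
Qed.

Lemma stable_Xn n : stable ('X^n : {poly C}).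
Proof.
move=> z hz; rewrite hornerXn expf_neq0 //.
by apply: contraTneq hz => ->; rewrite ltxx.
Qed.

(* For fixed [x] in the upper half-plane, [S(x, w) = heat_x (g (w (x - 2w)))] has no
   zero [w] in the lower half-plane, so [S(x, D)] preserves stability of [p]. *)
Lemma rr_wick_sum (g : {poly R}) n (p : {poly R}) : rr g -> (forall k, 0 <= g`_k) -> rr p ->
  rr (wick_sum (fun k => g`_k) (fun k => (heat n)`_k) (size p) p).
Proof.
move=> hg g0 /rr_stable[->|hp].
  by rewrite /wick_sum size_poly0 big_ord0; exact: rr0.
set e := fun k => (heat n)`_k.
have [/existsP ex|/existsPn nex] := boolP [exists k : 'I_(size p), g`_k != 0]; last first.
  rewrite /wick_sum big1 => [|k _]; first exact: rr0.
  by have := nex k; rewrite negbK => /eqP ->; rewrite scale0r.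
have gn0 : g != 0.
  by case: ex => k; apply: contraNneq => ->; rewrite coef0.
have exm : exists m, (m < size p)%N && (g`_m != 0).
  by case: ex => k hk; exists k; rewrite ltn_ord.
pose m := ex_minn exm.
have [mp gm mmin] : [/\ (m < size p)%N, g`_m != 0 & forall k, (k < m)%N -> g`_k = 0].
  rewrite /m; case: ex_minnP => j /andP[h1 h2] h3; split=> // k hk.
  apply/eqP/negPn/negP => h; have := h3 k; rewrite h (ltn_trans hk h1) => /(_ isT).
  by rewrite leqNgt hk.
apply: stable_rr => x hx.
pose D := (size p + size g)%N.
rewrite -(@wick_sum_bound _ _ D) ?leq_addr //.
pose h k := (cpoly (act e 'X^k)).[x].
(* The symbol as a polynomial in [w] with [x] frozen; freezing is harmless because the image is only
   evaluated at [x]. *)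
pose S : {poly C} := \sum_(k < D) \sum_(j < k.+1)
   ((g`_k)%:C%C * ('C(k, j)%:R * (-2) ^+ j) * h (k - j)%N) *: 'X^(j + k).
have hE k : h k = (act (fun i => (cpoly (heat n))`_i) 'X^k).[x].
  rewrite /h map_act map_polyXn; congr (_.[x]); apply: eq_act => i _.
  by rewrite coef_map.
have mapE c A B i : (cpoly (c *: (A * B^`(i)))).[x]
    = c%:C%C * ((cpoly A).[x] * ((cpoly B)^`(i)).[x]).
  by rewrite map_polyZ hornerZ rmorphM hornerM derivn_map.
have wE k : (cpoly (wick e k p)).[x] = \sum_(j < k.+1)
    ('C(k, j)%:R * (-2) ^+ j) * (h (k - j)%N * ((cpoly p)^`(j + k)).[x]).
  rewrite /wick rmorph_sum horner_sum; apply: eq_bigr => j _ /=.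
  apply: etrans (mapE _ _ _ _) _; congr (_ * _).
  by rewrite rmorphM rmorph_nat rmorphXn rmorphN rmorph_nat.
have -> : (cpoly (wick_sum (fun k => g`_k) e D p)).[x] = (act (fun k => S`_k) (cpoly p)).[x].
  rewrite /S /wick_sum act_suml rmorph_sum !horner_sum; apply: eq_bigr => k _.
  transitivity ((g`_k)%:C%C * (cpoly (wick e k p)).[x]).
    by rewrite /= map_polyZ hornerZ.
  rewrite act_suml horner_sum wE mulr_sumr; apply: eq_bigr => j _.
  rewrite (@eq_act _ _ (fun i => ((g`_k)%:C%C * ('C(k, j)%:R * (-2) ^+ j) * h (k - j)%N)
      * ('X^(j + k) : {poly C})`_i)); last by move=> i _; rewrite coefZ.
  by rewrite actZl act_Xn hornerZ !mulrA.
suff hst : stable (act (fun k => S`_k) (cpoly p)) by exact: hst hx.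
apply: act_stable => // [w hw|]; last first.
  exists m; first by rewrite size_map_poly.
  have mD : (m < D)%N by rewrite (leq_trans mp) // leq_addr.
  (* Terms have degree [j + k] in [w], and [g] vanishes below [m], so only [k = m], [j = 0] reaches
     degree [m]. *)
  have -> : S`_m = (g`_m)%:C%C * h m.
    rewrite /S coef_sum (bigD1 (Ordinal mD)) //= coef_sum big_ord_recl /=.
    rewrite bin0 expr0 subn0 !mulr1 coefZ coefXn add0n eqxx mulr1 big1 ?addr0; last first.
      move=> j _; rewrite coefZ coefXn ltn_eqF ?mulr0 // /bump leq0n add1n addSn ltnS.
      by rewrite leq_addl.
    rewrite big1 ?addr0 // => k hk; rewrite coef_sum big1 // => j _.
    rewrite coefZ coefXn; have [km|mk|km] := ltngtP k m.
    - by rewrite mmin // rmorph0 !mul0r.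
    - by rewrite ltn_eqF ?mulr0 // (leq_trans mk) // leq_addl.
    - by move/eqP: hk; case; apply: val_inj.
  rewrite mulf_neq0 ?fmorph_eq0 // hE; exact: heat_stable (stable_Xn m) _ hx.
have w0 : w != 0 by apply: contraTneq hw => ->; rewrite ltxx.
pose G := cpoly g \Po (w *: ('X - (2 * w)%:P)).
have hG : stable G.
  move=> z hz; rewrite /G horner_comp hornerZ hornerXsubC; apply/eqP => e0.
  (* A zero makes [u = w (z - 2w)] a nonpositive real. Then [z = 2w + u/w] with [Im (u/w) <= 0], so
     [Im z < 0], a contradiction. *)
  have [u0 u1] := rr_nonneg_root hg gn0 g0 e0.
  have zE : z = 2 * w + (w * (z - 2 * w)) / w by field.
  move: (w * (z - 2 * w)) u0 u1 zE {e0} => u u0 u1 zE.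
  have uw : 0 <= Re u * (Im w / sqnorm w).
    by rewrite mulr_le0 // pmulr_lle0 ?ltW // invr_gt0 sqnorm_gt0.
  move: hz; rewrite zE (_ : 2 * w = w + w); last by ring.
  by rewrite !Im_add Im_mul Im_inv u0; lra.
suff -> : S.[w] = (act (fun i => (cpoly (heat n))`_i) G).[x] by exact: heat_stable hG _ hx.
have -> : G = \sum_(k < D) ((g`_k)%:C%C * w ^+ k) *: ('X - (2 * w)%:P) ^+ k.
  rewrite /G comp_polyE size_map_poly.
  rewrite (big_ord_widen D (fun k => (cpoly g)`_k *: (w *: ('X - (2 * w)%:P)) ^+ k)) ?leq_addl //.
  rewrite big_mkcond; apply: eq_bigr => k _; rewrite coef_map exprZn scalerA.
  by case: ltnP => // hk; rewrite nth_default // rmorph0 mul0r scale0r.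
rewrite act_sum /S !horner_sum; apply: eq_bigr => k _.
rewrite actZ exprBn act_sum hornerZ !horner_sum mulr_sumr; apply: eq_bigr => j _.
have -> : (-1) ^+ j * 'X^(k - j) * (2 * w)%:P ^+ j *+ 'C(k, j)
    = ('C(k, j)%:R * ((-2) * w) ^+ j) *: 'X^(k - j) :> {poly C}.
  rewrite -mul_polyC mulNr !(polyCM, polyC_exp, polyCN, polyCMn, polyC1) -mulr_natr.
  by rewrite [(- (2 * _)) ^+ _]exprNn; ring.
by rewrite actZ !hornerZ hornerXn -hE exprMn exprD; ring.
Qed.

(** Coefficient form of [(exp(-t^2))' = -2t exp(-t^2)]. *)
Lemma eps_rec k : eps k.+2 *+ k.+2 = -2 * eps k.
Proof.
rewrite /eps /= negbK; case: ifPn => ok; first by rewrite mul0rn mulr0.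
have -> : k.+2 = (k./2.+1 * 2)%N by rewrite muln2 doubleS even_halfK.
have h1 : (k./2.+1)%:R != 0 :> R by rewrite pnatr_eq0.
have h2 : (k./2)`!%:R != 0 :> R by rewrite pnatr_eq0 -lt0n fact_gt0.
rewrite factS natrM exprS mulrnA -[X in X *+ 2]mulr_natr -[X in X = _]mulr_natr.
move: (k./2.+1%:R : R) (k./2`!%:R : R) h1 h2 => x y x0 y0; field.
by rewrite x0 y0.
Qed.

Lemma eps1 : eps 1 = 0. Proof. by []. Qed.

(* Pincherle derivative: [[exp(-D^2), x] = -2 D exp(-D^2)]. *)
Lemma act_eps_mulX (f : {poly R}) :
  act eps ('X * f) = 'X * act eps f - 2 *: (act eps f)^`().
Proof.
have dX k : ('X * f)^`(k.+1) = 'X * f^`(k.+1) + f^`(k) *+ k.+1.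
  by rewrite mulrC -[f * 'X]addr0 -polyC0 derivnMXaddC addrC mulrC.
set n := (size f).+2.
rewrite (@act_bound _ _ ('X * f) n); last first.
  by rewrite (leq_trans (size_polyMleq _ _)) // size_polyX.
rewrite -act_deriv (@act_bound _ _ f n) ?leqW // (@act_bound _ _ f^`() (size f)); last first.
  exact: size_deriv_leq.
rewrite big_ord_recl [in RHS]big_ord_recl !derivn0 mulrDr -!addrA; congr (_ + _).
  by rewrite -scalerAr.
under eq_bigr => k _ do rewrite lift0 dX scalerDr.
rewrite big_split /= mulr_sumr; congr (_ + _).
  by apply: eq_bigr => k _; rewrite /bump leq0n add1n add0n -scalerAr.
rewrite big_ord_recl /= eps1 scale0r add0r scaler_sumr -sumrN.
apply: eq_bigr => k _; rewrite /bump leq0n add1n add0n -derivnS derivSn -scalerMnr scalerMnl.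
by rewrite eps_rec scalerA mulNr scaleNr.
Qed.

Lemma act_eps1 : act eps 1 = 1.
Proof. by rewrite /act size_poly1 big_ord1 derivn0 eps0 scale1r. Qed.

(** Conjugation by [E] turns multiplication by [x^k] into [(x - 2D)^k]; the left side is its
    normally ordered form. Induction on [k] with [act_eps_mulX]. *)
Lemma act_eps_Xn_mul k (q : {poly R}) :
  \sum_(m < k.+1) ('C(k, m)%:R * (-2) ^+ m) *: (act eps 'X^(k - m) * (act eps q)^`(m))
  = act eps ('X^k * q).
Proof.
elim: k => [|k IH].
  by rewrite big_ord1 /= bin0 !expr0 !mul1r scale1r act_eps1 mul1r.
rewrite exprS -mulrA act_eps_mulX -IH {IH}; set p := act eps q.
pose F m j := (-2) ^+ m *: (act eps 'X^j * p^`(m)).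
have FE n : \sum_(m < n.+1) ('C(n, m)%:R * (-2) ^+ m) *: (act eps 'X^(n - m) * p^`(m))
   = \sum_(m < n.+1) F m (n - m)%N *+ 'C(n, m).
  by apply: eq_bigr => m _; rewrite -scalerA scaler_nat.
rewrite !FE sum_pascal -big_split /= mulr_sumr raddf_sum /= scaler_sumr -sumrB.
apply: eq_bigr => m _; rewrite derivMn mulrnAr -scalerMnr -mulrnBl -mulrnDl.
congr (_ *+ _); rewrite /F exprS act_eps_mulX derivZ derivM -derivnS exprS.
move: ((-2) ^+ m) => c; rewrite -!mul_polyC polyCM polyCN; ring.
Qed.

Lemma wick_eps k (q : {poly R}) : wick eps k (act eps q) = act eps ('X^k * q^`(k)).
Proof.
rewrite -act_eps_Xn_mul act_derivn; apply: eq_bigr => m _.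
congr (_ *: (_ * _)); elim: (nat_of_ord m) => [|j IH]; first by rewrite derivn0.
by rewrite addSn !derivnS IH.
Qed.

(** Since [x^k D^k x^i = k! C(i,k) x^i], Newton's forward formula expands the multiplier in the
    operators [x^k D^k], which [wick_eps] conjugates. *)
Lemma wick_sum_eps (lam : nat -> R) n (q : {poly R}) : (size q <= n)%N ->
  wick_sum (fun k => diffs lam k / k`!%:R) eps n (act eps q) = act eps (mult lam q).
Proof.
move=> sq; rewrite /wick_sum.
under eq_bigr => k _ do rewrite wick_eps -actZ.
rewrite -act_sum; congr (act eps _); apply/polyP => i; rewrite coef_sum coef_mult.
have [iq|iq] := leqP (size q) i.
  rewrite nth_default // mulr0 big1 // => k _; rewrite coefZ coefXnM coef_derivn.
  case: ltnP => ki; first by rewrite mulr0.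
  by rewrite subnKC // nth_default // mul0rn mulr0.
rewrite (newton_forward lam i) mulr_suml.
rewrite (big_ord_widen n (fun k => diffs lam k *+ 'C(i, k) * q`_i)) ?(leq_trans iq) //.
rewrite [RHS]big_mkcond /=; apply: eq_bigr => k _; rewrite coefZ coefXnM coef_derivn ltnS.
case: leqP => ki; last by rewrite mulr0.
rewrite subnKC // -bin_ffact mulrnA -[q`_i *+ _ *+ _]mulr_natr -[q`_i *+ _]mulr_natr.
have h : (k`!)%:R != 0 :> R by rewrite pnatr_eq0 -lt0n fact_gt0.
by rewrite -[diffs _ _ *+ _]mulr_natr; move: (k`!%:R) h => x x0; field.
Qed.

Lemma size_derivn_leq m (p : {poly R}) : (size p^`(m) <= size p)%N.
Proof. by elim: m => // m IH; rewrite derivnS (leq_trans (size_deriv_leq _)). Qed.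

Lemma size_wick_sum g e n (p : {poly R}) : (size (wick_sum g e n p) <= n + size p)%N.
Proof.
apply/leq_sizeP => i hi; rewrite coef_sum big1 // => k _.
rewrite coefZ coef_sum big1 ?mulr0 // => m _; rewrite coefZ nth_default ?mulr0 //.
apply: leq_trans (size_polyMleq _ _) _.
have h1 : (size (act e 'X^(k - m)) <= (k - m).+1)%N.
  by rewrite (leq_trans (size_act _ _)) // size_polyXn.
have h2 := size_derivn_leq (m + k) p; have h3 := ltn_ord k.
by move: (size _) (size _) h1 h2 => a b; lia.
Qed.

Lemma cv_wick_sum (g e : nat -> nat -> R) g' e' n (p : {poly R}) i :
  (forall k, Un_cv (g^~ k) (g' k)) -> (forall k, Un_cv (e^~ k) (e' k)) ->
  Un_cv (fun N => (wick_sum (g N) (e N) n p)`_i) (wick_sum g' e' n p)`_i.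
Proof.
move=> hg he.
have cvt k m : Un_cv (fun N => (act (e N) 'X^(k - m) * p^`(m + k))`_i)
                     (act e' 'X^(k - m) * p^`(m + k))`_i.
  rewrite coefM; apply: (@cv_ext (fun N => \sum_(j < i.+1)
    (act (e N) 'X^(k - m))`_j * (p^`(m + k))`_(i - j))).
    by move=> N; rewrite coefM.
  apply: cv_sum => j; apply: cvM _ (cv_const _).
  apply: (@cv_act e e' (fun=> 'X^(k - m)) 'X^(k - m) (k - m).+1) => // [_||l].
  - by rewrite size_polyXn.
  - by rewrite size_polyXn.
  - exact: cv_const.
have cvk k : Un_cv (fun N => (wick (e N) k p)`_i) (wick e' k p)`_i.
  rewrite coef_sum; apply: (@cv_ext (fun N => \sum_(m < k.+1) ('C(k, m)%:R * (-2) ^+ m) *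
      (act (e N) 'X^(k - m) * p^`(m + k))`_i)).
    by move=> N; rewrite coef_sum; apply: eq_bigr => m _; rewrite coefZ.
  under [X in Un_cv _ X]eq_bigr => m _ do rewrite coefZ.
  by apply: cv_sum => m; apply: cvM (cv_const _) _.
rewrite coef_sum; apply: (@cv_ext (fun N => \sum_(k < n) g N k * (wick (e N) k p)`_i)).
  by move=> N; rewrite coef_sum; apply: eq_bigr => k _; rewrite coefZ.
under [X in Un_cv _ X]eq_bigr => k _ do rewrite coefZ.
by apply: cv_sum => k; apply: cvM.
Qed.

Lemma rr_mult_rr_eps_mult lam : rr_mult lam -> (forall n, 0 <= lam n) ->
  (forall n, lam n <= lam n.+1) -> rr_eps_mult lam.
Proof.
move=> hl l0 lm q hp; have hj := rr_mult_jensen hl.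
have mu0 := diffs_ge0 hj l0 lm; have hmu := jensen_rr_diffs hj.
rewrite -(wick_sum_eps lam (leqnn _)) (wick_sum_bound _ _ (size_act _ _)).
move: (act eps q) hp => p hp.
(* Rescaling by [1/(N+1)] keeps real-rootedness and nonnegative coefficients and makes the k-th
   coefficient tend to [diffs lam k / k!]. *)
pose g N : {poly R} := jensen N.+1 (diffs lam) \Po (N.+1%:R^-1 *: 'X).
have gE N k : (g N)`_k = diffs lam k * binom_ratio N k.
  rewrite /g coef_comp_scale coef_jensen exprVn /binom_ratio.
  by rewrite -[diffs lam k *+ _]mulr_natr mulrC mulrA.
apply: (@rr_closed (fun N => wick_sum (fun k => (g N)`_k) (fun k => (heat N)`_k) (size p) p)
          _ (size p + size p)).
- move=> N; apply: rr_wick_sum => // [|k].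
    by apply: rr_comp_scale; rewrite ?invr_gt0 ?ltr0n //; exact: hmu.
  by rewrite gE mulr_ge0 // divr_ge0 ?ler0n // exprn_ge0.
- by move=> N; exact: size_wick_sum.
move=> i; apply: (@cv_wick_sum (fun N k => (g N)`_k) (fun N k => (heat N)`_k)) => k.
  apply: cv_ext (cvM (cv_const (diffs lam k)) (cv_binom_ratio k)) => N.
  by rewrite gE.
exact: cv_heat.
Qed.

End Sufficiency.

(** * Polynomial functions *)

Section Translation.
Local Open Scope ring_scope.
Local Bind Scope ring_scope with Rdefinitions.RbaseSymbolsImpl.R.

Lemma real_rooted_ext (f g : R -> R) : f =1 g -> real_rooted f -> real_rooted g.
Proof. by move=> h [c [rs hf]]; exists c, rs => x; rewrite -h. Qed.

Lemma fold_right_prod (x : R) rs :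
  List.fold_right (fun r acc => Rmult (Rminus x r) acc) 1%R rs = \prod_(r <- rs) (x - r).
Proof. by elim: rs => [|r rs IH]; rewrite ?big_nil // big_cons /= IH. Qed.

(** Agreement as functions gives equality of polynomials, tested at the natural numbers. *)
Lemma real_rooted_horner (P : {poly R}) : real_rooted (fun x => P.[x]) <-> rr P.
Proof.
split=> [[c [rs h]]|[c [rs ->]]]; exists c, rs; last first.
  by move=> x; rewrite hornerZ horner_prod_XsubC fold_right_prod.
apply/eqP; rewrite -subr_eq0; apply/eqP; apply: (@poly0_inj _ _ (fun k => k%:R)).
  by move=> i j /eqP; rewrite eqr_nat => /eqP.
move=> k; rewrite hornerD hornerN hornerZ horner_prod_XsubC h fold_right_prod.
exact: subrr.
Qed.

Lemma sum_f_R0_big (F : nat -> R) n : sum_f_R0 F n = \sum_(i < n.+1) F i.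
Proof. by elim: n => [|n IH]; rewrite ?big_ord1 // big_ord_recr /= IH. Qed.

Lemma lincomb_monomial c n x : lincomb monomial c n x = (\poly_(i < n.+1) c i).[x].
Proof.
rewrite /lincomb sum_f_R0_big horner_poly; apply: eq_bigr => i _.
by rewrite /monomial RpowE.
Qed.

Lemma div2_half n : Nat.div2 n = n./2.
Proof.
suff : Nat.div2 n = n./2 /\ Nat.div2 n.+1 = n.+1./2 by case.
by elim: n => // n [h1 h2]; split=> //=; rewrite h1.
Qed.

Lemma fact_factorial n : Factorial.fact n = n`!.
Proof. by elim: n => // n IH; rewrite factS -IH. Qed.

Lemma sum_even (V : nmodType) n (G : nat -> V) :
  \sum_(k < n.+1) (if odd k then 0 else G k./2) = \sum_(j < n./2.+1) G j.
Proof.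
elim: n => [|n IH]; first by rewrite !big_ord1.
rewrite big_ord_recr /= IH uphalf_half; case: (odd n) => /=.
  by rewrite add1n [in RHS]big_ord_recr.
by rewrite add0n addr0.
Qed.

(** [D^(2j)] applied to [X^n] produces the falling factorial [n!/(n-2j)!] of the explicit formula;
    odd orders vanish in [eps]. *)
Lemma hermite_horner n x : hermite n x = (act eps 'X^n).[2 * x].
Proof.
rewrite /hermite sum_f_R0_big div2_half.
rewrite (@act_bound _ _ _ n.+1) ?size_polyXn // horner_sum.
pose G j := (-1) ^+ j / j`!%:R * ((n ^_ (j.*2))%:R * (2 * x) ^+ (n - j.*2)).
transitivity (\sum_(k < n.+1) (if odd k then 0 else G k./2)).
  rewrite sum_even; apply: eq_bigr => j _.
  have jn : (j.*2 <= n)%N by have := ltn_ord j; lia.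
  rewrite /G !RpowE !INRE !fact_factorial.
  have -> : Nat.sub n (Nat.mul 2 j) = (n - j.*2)%N by rewrite -mul2n.
  have -> : IZR 2 = 2 by [].
  have -> : IZR (-1) = -1 by [].
  rewrite -(ffact_fact jn) natrM.
  have h1 : j`!%:R != 0 :> R by rewrite pnatr_eq0 -lt0n fact_gt0.
  have h2 : (n - j.*2)`!%:R != 0 :> R by rewrite pnatr_eq0 -lt0n fact_gt0.
  rewrite !RmultE RdivE; move: (j`!%:R) ((n - j.*2)`!%:R) h1 h2 => u v u0 v0.
  have E (a f p : R) : a * (f * v) / (u * v) * p = a / u * (f * p).
    by field; rewrite u0 v0.
  exact: E.
apply: eq_bigr => k _; rewrite hornerZ derivnXn hornerMn hornerXn /eps.
case: ifPn => ok; first by rewrite mul0r.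
by rewrite /G even_halfK // mulr_natl.
Qed.

Lemma lincomb_hermite c n x :
  lincomb hermite c n x = (act eps (\poly_(i < n.+1) c i) \Po (2 *: 'X)).[x].
Proof.
rewrite /lincomb sum_f_R0_big horner_comp hornerZ hornerX poly_def act_sum horner_sum.
by apply: eq_bigr => i _; rewrite actZ hornerZ hermite_horner.
Qed.

Lemma rr_comp_scaleE (a : R) P : 0 < a -> rr (P \Po (a *: 'X)) <-> rr P.
Proof.
move=> a0; split; last exact: rr_comp_scale.
have ai : 0 < a^-1 by rewrite invr_gt0.
move=> /(rr_comp_scale ai); congr rr; apply/polyP => i.
by rewrite !coef_comp_scale mulrA -exprMn mulVf ?gt_eqF // expr1n mul1r.
Qed.

Lemma mult_poly (lam c : nat -> R) n :
  mult lam (\poly_(i < n) c i) = \poly_(i < n) (lam i * c i).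
Proof. by apply/polyP => i; rewrite coef_mult !coef_poly; case: ifP => // _; rewrite mulr0. Qed.

(** The bound [size q + 1] fits the [n + 1] terms of [lincomb] even for [q = 0]. *)
Lemma poly_nth (q : {poly R}) : \poly_(i < (size q).+1) q`_i = q.
Proof.
by apply/polyP => i; rewrite coef_poly; case: ltnP => // h; rewrite nth_default // ltnW.
Qed.

Lemma classical_multiplierE lam : classical_multiplier_sequence lam <-> rr_mult lam.
Proof.
have E c n : real_rooted (lincomb monomial c n) <-> rr (\poly_(i < n.+1) c i).
  rewrite -real_rooted_horner; split; apply: real_rooted_ext => x;
    by rewrite lincomb_monomial.
split=> h.
  move=> q; rewrite -(poly_nth q) => /E /h /E.
  by rewrite mult_poly.
by move=> c n /E /h; rewrite mult_poly => /E.
Qed.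

Lemma hermite_multiplierE lam : hermite_multiplier_sequence lam <-> rr_eps_mult lam.
Proof.
have E c n : real_rooted (lincomb hermite c n) <-> rr (act eps (\poly_(i < n.+1) c i)).
  rewrite -(rr_comp_scaleE _ (ltr0n _ 2 : 0 < 2)) -real_rooted_horner.
  by split; apply: real_rooted_ext => x; rewrite lincomb_hermite.
split=> h.
  move=> q; rewrite -(poly_nth q) => /E /h /E.
  by rewrite mult_poly.
by move=> c n /E /h; rewrite mult_poly => /E.
Qed.

End Translation.

Open Scope R_scope.

Theorem theorem3p1 (lam : nat -> R)
  (Hnontriv : ~ trivial_sequence lam)
  (Hnonneg : forall n : nat, 0 <= lam n) :
  hermite_multiplier_sequence lam <->
  (classical_multiplier_sequence lam /\ forall n : nat, lam n <= lam (S n)).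
Proof.
have l0 n : (0 <= lam n)%O by exact/RleP.
rewrite hermite_multiplierE classical_multiplierE; split=> [h|[h hm]].
  split; first exact: rr_eps_mult_rr_mult.
  by move=> n; apply/RleP; apply: eps_mult_nondecreasing.
apply: rr_mult_rr_eps_mult => // n; exact/RleP.
Qed.
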